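(* Fix a real number $\rho$ with $|\rho|<1$, as well as commutation coefficients $\{s_{i,j}\}_{1\le i<j}$ and $\{r_{i,j}\}_{i,j\in\mathbb{N}}$ in $\{-1,1\}$. Write $s(i,j)=s_{i,j}$ and $r(i,j)=r_{i,j}$, where $s(j,i):=s(i,j)$ for $i<j$. Consider the Hilbert space $\mathbb{C}^2$ and the vector $(1,0)\in\mathbb{C}^2$, and let $(K,v)=\bigotimes_{i\in\mathbb{N}}(\mathbb{C}^2,(1,0))$ be the infinite tensor product of $\mathbb{C}^2$ with itself with respect to the constant stabilizing sequence given by $(1,0)$, with distinguished unit vector $v=(1,0)\otimes(1,0)\otimes\cdots$. For $x\in\{-1,1\}$ let $\sigma_x,\gamma,\tau$ be the operators on $\mathbb{C}^2$ given by $$\sigma_x=\begin{bmatrix}1&0\\0&x\end{bmatrix},\qquad \gamma=\begin{bmatrix}0&1\\1&0\end{bmatrix},\qquad \tau=\begin{bmatrix}\rho&\sqrt{1-\rho^2}\\ \sqrt{1-\rho^2}&-\rho\end{bmatrix},$$ let $I$ be the identity on $\mathbb{C}^2$, and for $i=1,2,\dots$ consider the following bounded operators on $K$: $$\zeta_i=\sigma_{s(1,i)}\otimes\sigma_{s(2,i)}\otimes\cdots\otimes\sigma_{s(i-1,i)}\otimes\gamma\otimes I\otimes I\otimes\cdots,$$ $$\alpha_i=I^{\otimes(i-1)}\otimes\gamma\otimes I\otimes I\otimes\cdots,$$ $$\beta_i=\sigma_{s(1,i)r(1,i)}\otimes\cdots\otimes\sigma_{s(i-1,i)r(i-1,i)}\otimes\gamma\otimes\sigma_{s(i+1,i)r(i+1,i)}\otimes\sigma_{s(i+2,i)r(i+2,i)}\otimes\cdots,$$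 $$\eta_i=I^{\otimes(i-1)}\otimes\tau\otimes I\otimes I\otimes\cdots,$$ $$\theta_i=I\otimes I\otimes\cdots .$$ Let $\mathcal{A}:=\mathscr{B}(K^{\otimes 3})$ be the algebra of bounded operators on $K\otimes K\otimes K$, and let $\varphi$ be the vector state on $\mathcal{A}$ corresponding to the vector $v^{\otimes 3}$, i.e. $\varphi(T)=\langle v^{\otimes3},T v^{\otimes 3}\rangle$. Then the sequences $(a_i)_{i\in\mathbb{N}}$ and $(b_i)_{i\in\mathbb{N}}$ of elements of $\mathcal{A}$ given by $$a_i=\zeta_i\otimes\alpha_i\otimes\eta_i,\qquad b_i=\zeta_i\otimes\beta_i\otimes\theta_i$$ satisfy the Main Hypotheses (self-adjointness and (H1)--(H5), listed in the context) with respect to $\varphi$, with the given $\rho$ and commutation coefficients.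
   Context: **Infinite tensor product.** $K$ is the Hilbert space completion of the span of elementary tensors $x_1\otimes x_2\otimes\cdots$ with $x_i\in\mathbb{C}^2$ and $x_i=(1,0)$ for all but finitely many $i$, with inner product $\langle x_1\otimes x_2\otimes\cdots,\,y_1\otimes y_2\otimes\cdots\rangle=\prod_i\langle x_i,y_i\rangle$. An operator $T_1\otimes T_2\otimes\cdots$ acts by $(T_1\otimes T_2\otimes\cdots)(x_1\otimes x_2\otimes\cdots)=T_1x_1\otimes T_2x_2\otimes\cdots$; for the operators considered here, all but finitely many $T_i$ are contractions fixing $(1,0)$, so this is well defined and bounded on $K$. In the formulas for $\zeta_i$, $\alpha_i$, $\beta_i$, the factor $\gamma$ is in the $i$-th tensor position; in $\eta_i$, the factor $\tau$ is in the $i$-th position. **Main Hypotheses.** Let $\mathcal{A}$ be a unital $*$-algebra with a state $\varphi$ (a linear functional with $\varphi(a^*a)\geq0$ for all $a\in\mathcal{A}$ and $\varphi(1)=1$). For two sequences $(a_i)_{i\in\mathbb{N}}$ and $(b_i)_{i\in\mathbb{N}}$ of self-adjoint elements of $\mathcal{A}$ (with $\mathbb{N}=\{1,2,\dots\}$), the Main Hypotheses are: - (H1) For all $i\in\mathbb{N}$, $\varphi(a_i)=\varphi(b_i)=0$. - (H2) For all $i\in\mathbb{N}$, $\varphi(a_i^2)=\varphi(b_i^2)=1$ and $\varphi(a_ib_i)=\rho\in(-1,1)$. - (H3) There is a sequence $(\gamma_n)_{n\in\mathbb{N}}$ in $\mathbb{R}_+$ such that for all $n\in\mathbb{N}$,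 all $i(1),\dots,i(n)\in\mathbb{N}$ and all choices $c_j\in\{a_{i(j)},b_{i(j)}\}$ ($1\le j\le n$), $|\varphi(c_1c_2\cdots c_n)|\le\gamma_n$. - (H4) Let $\mathcal{A}_i$ be the unital $*$-subalgebra of $\mathcal{A}$ generated by $\{a_i,b_i\}$. For all $k\in\mathbb{N}$, all $i(1)<i(2)<\dots<i(k)$ and all $g_{i(m)}\in\mathcal{A}_{i(m)}$ ($1\le m\le k$), $\varphi(g_{i(1)}\cdots g_{i(k)})=\varphi(g_{i(1)})\cdots\varphi(g_{i(k)})$. - (H5) There are sequences $(s_{i,j})_{i,j\in\mathbb{N}}$ and $(r_{i,j})_{i,j\in\mathbb{N}}$ in $\{-1,1\}$ (the commutation coefficients) such that for all $i\ne j$: $a_ia_j=s_{i,j}\,a_ja_i$, $\ b_ib_j=s_{i,j}\,b_jb_i$, $\ a_ib_j=r_{i,j}\,b_ja_i$.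
   Formalization: The formal theorem also assumes r(i,j)=r(j,i) for all i,j; without it the claim fails, since b_i b_j = s(i,j) r(i,j) r(j,i) b_j b_i with b_j b_i nonzero, so (H5) for the b's holds exactly when r is symmetric. *)

(* Defs.v *)
From HB Require Import structures.
From mathcomp Require Import all_boot all_order all_algebra.
From mathcomp Require Import complex.
From mathcomp Require Import all_classical all_reals all_analysis.
From mathcomp Require Import ring lra.

Set Implicit Arguments.
Unset Strict Implicit.
Unset Printing Implicit Defensive.

Import Order.TTheory GRing.Theory Num.Theory.
Import numFieldNormedType.Exports.

Local Open Scope classical_set_scope.
Local Open Scope complex_scope.
Local Open Scope ring_scope.

(* Nonzero complex Hilbert spaces (nonzero so that the bounded operators form *)
(* an algType, where 1 != 0). The inner product is linear in its second       *)
(* argument, so that T |-> <w, T w> is linear.                                *)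
HB.mixin Record CompleteNormedModule_isHilbert (R : realType) H
    of CompleteNormedModule R[i] H := {
  hdot : H -> H -> R[i];
  hdot_linear : forall x : H, scalar (hdot x);
  hdotC : forall x y : H, hdot y x = (hdot x y)^* ;
  hdot_norm : forall x : H, hdot x x = `|x| ^+ 2;
  hilbert_nonzero : exists x : H, x != 0
}.

#[short(type="hilbertType")]
HB.structure Definition Hilbert (R : realType) :=
  {H of CompleteNormedModule R[i] H & CompleteNormedModule_isHilbert R H}.

Section HilbertTheory.
Variables (R : realType) (H : hilbertType R).
Implicit Types (x y z : H) (c : R[i]).
Local Notation Re := (@complex.Re R).

Lemma hdotDr x y z : hdot x (y + z) = hdot x y + hdot x z.
Proof. by have := hdot_linear x 1 y z; rewrite scale1r mul1r. Qed.

Lemma hdot0r x : hdot x 0 = 0.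
Proof. by apply: (addIr (hdot x 0)); rewrite add0r -hdotDr addr0. Qed.

Lemma hdotZr c x y : hdot x (c *: y) = c * hdot x y.
Proof. by have := hdot_linear x c y 0; rewrite hdot0r !addr0. Qed.

Lemma hdotNr x y : hdot x (- y) = - hdot x y.
Proof. by rewrite -scaleN1r hdotZr mulN1r. Qed.

Lemma hdotDl x y z : hdot (x + y) z = hdot x z + hdot y z.
Proof. by rewrite !(hdotC z) hdotDr rmorphD. Qed.

Lemma hdotZl c x y : hdot (c *: x) y = c^* * hdot x y.
Proof. by rewrite !(hdotC y) hdotZr rmorphM. Qed.

Lemma hdotNl x y : hdot (- x) y = - hdot x y.
Proof. by rewrite !(hdotC y) hdotNr rmorphN. Qed.

Definition rdot x y : R := Re (hdot x y).
Definition hsq x : R := rdot x x.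

Lemma ReD (a b : R[i]) : Re (a + b) = Re a + Re b. Proof. by case: a; case: b. Qed.
Lemma ReN (a : R[i]) : Re (- a) = - Re a. Proof. by case: a. Qed.
Lemma ReRM (t : R) (a : R[i]) : Re (t%:C * a) = t * Re a.
Proof. by case: a => a b /=; rewrite mul0r subr0. Qed.

Lemma rdotDr x y z : rdot x (y + z) = rdot x y + rdot x z.
Proof. by rewrite /rdot hdotDr ReD. Qed.
Lemma rdotDl x y z : rdot (x + y) z = rdot x z + rdot y z.
Proof. by rewrite /rdot hdotDl ReD. Qed.
Lemma rdotNr x y : rdot x (- y) = - rdot x y.
Proof. by rewrite /rdot hdotNr ReN. Qed.
Lemma rdotNl x y : rdot (- x) y = - rdot x y.
Proof. by rewrite /rdot hdotNl ReN. Qed.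
Lemma rdotC x y : rdot x y = rdot y x.
Proof. by rewrite /rdot (hdotC y); case: (hdot y x). Qed.
Lemma rdotZr (t : R) x y : rdot x (t%:C *: y) = t * rdot x y.
Proof. by rewrite /rdot hdotZr ReRM. Qed.
Lemma rdotZl (t : R) x y : rdot (t%:C *: x) y = t * rdot x y.
Proof. by rewrite rdotC rdotZr rdotC. Qed.

Definition rdotE :=
  (rdotDl, rdotDr, rdotNl, rdotNr, rdotZl, rdotZr).

Lemma hdot_hsq x : hdot x x = (hsq x)%:C.
Proof.
rewrite /hsq /rdot hdot_norm.
have : 0 <= `|x| ^+ 2 by rewrite exprn_ge0.
by case: (`|x| ^+ 2) => a b; rewrite lecE/= => /andP[/eqP-> _].
Qed.

Lemma hsq_ge0 x : 0 <= hsq x.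
Proof. by rewrite -lecR -hdot_hsq hdot_norm exprn_ge0. Qed.

Lemma hsq_eq0 x : hsq x = 0 -> x = 0.
Proof.
move=> h; have := hdot_norm x; rewrite hdot_hsq h => /esym/eqP.
by rewrite sqrf_eq0 normr_eq0 => /eqP.
Qed.

Lemma norm_hsq x : `|x| = (Num.sqrt (hsq x))%:C.
Proof.
apply/eqP; rewrite -(@eqrXn2 _ 2) ?normr_ge0//; last first.
  by rewrite lecR sqrtr_ge0.
by rewrite -rmorphXn/= sqr_sqrtr ?hsq_ge0// -hdot_norm hdot_hsq.
Qed.

Lemma rdot_CS x y : rdot x y ^+ 2 <= hsq x * hsq y.
Proof.
have h (t : R) : 0 <= hsq x + 2 * t * rdot x y + t ^+ 2 * hsq y.
  have := hsq_ge0 (x + t%:C *: y).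
  by rewrite /hsq !rdotE (rdotC y x); nra.
have y0 := hsq_ge0 y.
case: (eqVneq (hsq y) 0) => [yz|yn].
  by rewrite (hsq_eq0 yz) /hsq /rdot !hdot0r /= expr0n/= mulr0.
have yp : 0 < hsq y by rewrite lt_neqAle eq_sym yn.
have := h (- rdot x y / hsq y).
rewrite -(ler_pM2r yp) mul0r.
suff -> : (hsq x + 2 * (- rdot x y / hsq y) * rdot x y
   + (- rdot x y / hsq y) ^+ 2 * hsq y) * hsq y
   = hsq x * hsq y - rdot x y ^+ 2 by rewrite subr_ge0.
by field.
Qed.

Lemma hdot_inj x y : (forall z, hdot x z = hdot y z) -> x = y.
Proof.
move=> h; apply/eqP; rewrite -subr_eq0; apply/eqP/hsq_eq0.
by rewrite /hsq /rdot hdotDl hdotNl h subrr.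
Qed.

Lemma hilbert_complete (u : nat -> H) :
  (forall e : R, 0 < e -> exists N, forall n, (N <= n)%N -> hsq (u N - u n) < e) ->
  exists l, forall e : R, 0 < e -> exists n0, forall n, (n0 <= n)%N -> hsq (u n - l) < e.
Proof.
move=> hu.
have cv : cvg (u @ \oo).
  apply: cauchy_cvg; apply: cauchy_exP => eps eps0.
  have e0 : 0 < Re eps by move: eps0; case: eps => a b; rewrite ltcE/= => /andP[].
  have epsE : eps = (Re eps)%:C.
    by move: eps0; case: eps {e0} => a b; rewrite ltcE/= => /andP[/eqP-> _].
  have [N hN] := hu (Re eps ^+ 2) (exprn_gt0 _ e0).
  exists (u N); exists N => // n /= Nn.
  rewrite -ball_normE /ball_/= norm_hsq epsE ltcR.
  rewrite -(@ltr_pXn2r _ 2) ?nnegrE ?sqrtr_ge0 ?ltW//.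
  by rewrite sqr_sqrtr ?hsq_ge0//; exact: hN.
exists (lim (u @ \oo)) => e e0.
have s0 : 0 < (Num.sqrt e)%:C by rewrite ltcR sqrtr_gt0.
have /cvgrPdist_lt/(_ _ s0)[n0 _ hn] : u @ \oo --> lim (u @ \oo) := cv.
exists n0 => n /hn /=; rewrite distrC norm_hsq ltcR.
by rewrite ltr_sqrt.
Qed.

Lemma riesz (f : H -> R[i]) (m : R) : scalar f ->
  (forall x, Re (f x) ^+ 2 <= m * hsq x) ->
  exists x, forall y, hdot x y = f y.
Proof.
move=> fl fb.
have fD x y : f (x + y) = f x + f y.
  by have := fl 1 x y; rewrite scale1r mul1r.
have f0 : f 0 = 0 by apply: (addIr (f 0)); rewrite add0r -fD addr0.
have fZ c x : f (c *: x) = c * f x by have := fl c x 0; rewrite f0 !addr0.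
pose g x := Re (f x).
have gD x y : g (x + y) = g x + g y by rewrite /g fD ReD.
have gZ (t : R) x : g (t%:C *: x) = t * g x by rewrite /g fZ ReRM.
pose Phi x := hsq x - 2 * g x.
pose E := [set Phi x | x in [set: H]].
have lbE : lbound E (- `|m|).
  move=> _ [x _ <-]; rewrite /Phi.
  have := fb x; rewrite -/(g x) => b.
  have q0 := hsq_ge0 x.
  have mm : m * hsq x <= `|m| * hsq x by rewrite ler_wpM2r// ler_norm.
  have m0 := normr_ge0 m.
  have b2 : g x ^+ 2 <= `|m| * hsq x by exact: le_trans mm.
  move: b2 m0 q0; move: (g x) (hsq x) `|m| => p q M b2 m0 q0.
  have h : (2 * p) ^+ 2 <= (q + M) ^+ 2.
    have := sqr_ge0 (q - M); nra.
  have : `|2 * p| <= `|q + M| by rewrite -ler_sqr ?nnegrE// !real_normK ?num_real.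
  rewrite (ger0_norm (addr_ge0 q0 m0)).
  have := ler_norm (2 * p); lra.
have Einf : has_inf E.
  by split; [exists (Phi 0); exists 0|exists (- `|m|)].
pose d := inf E.
have dle x : d <= Phi x by apply: ge_inf; [case: Einf|exists x].
have ex n : exists x, Phi x < d + n.+1%:R^-1.
  have e0 : 0 < n.+1%:R^-1 :> R by rewrite invr_gt0 ltr0n.
  by have [_ [x _ <-] hx] := inf_adherent e0 Einf; exists x.
have [u hu] := choice ex.
have epar k n : hsq (u k - u n) <= 2 * k.+1%:R^-1 + 2 * n.+1%:R^-1.
  have := dle ((2^-1)%:C *: (u k + u n)).
  have := hu k; have := hu n.
  rewrite /Phi /hsq !rdotE gZ gD (rdotC (u n) (u k)).
  move: (k.+1%:R^-1) (n.+1%:R^-1) => a b. lra.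
have small (e : R) : 0 < e -> exists N, forall n, (N <= n)%N -> n.+1%:R^-1 < e.
  move=> e0; have [N _ hN] := near_infty_natSinv_lt (PosNum e0).
  by exists N => n Nn; apply: hN.
have [l hl] : exists l, forall e : R, 0 < e ->
    exists n0, forall n, (n0 <= n)%N -> hsq (u n - l) < e.
  apply: hilbert_complete => e e0.
  have [|N hN] := small (e / 4); first by rewrite divr_gt0.
  exists N => n Nn; apply: le_lt_trans (epar N n) _.
  have := hN N (leqnn _); have := hN n Nn.
  by move: (N.+1%:R^-1) (n.+1%:R^-1) => a b; lra.
have gE y : rdot l y = g y.
  have step n : (rdot (u n) y - g y) ^+ 2 <= n.+1%:R^-1 * hsq y.
    have h (t : R) : 0 <= n.+1%:R^-1 + 2 * t * (rdot (u n) y - g y) + t ^+ 2 * hsq y.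
      have := dle (u n + t%:C *: y); have := hu n.
      rewrite /Phi /hsq !rdotE gD gZ (rdotC y (u n)).
      by move: (n.+1%:R^-1) => a; nra.
    have y0 := hsq_ge0 y.
    case: (eqVneq (hsq y) 0) => [yz|yn].
      have -> : y = 0 by exact: hsq_eq0.
      by rewrite /g f0 /hsq /rdot !hdot0r /= subrr expr0n/= mulr0.
    have yp : 0 < hsq y by rewrite lt_neqAle eq_sym yn.
    have := h (- (rdot (u n) y - g y) / hsq y).
    move: (n.+1%:R^-1) (rdot (u n) y - g y) => a b.
    rewrite -(ler_pM2r yp) mul0r.
    suff -> : (a + 2 * (- b / hsq y) * b + (- b / hsq y) ^+ 2 * hsq y) * hsq y
      = a * hsq y - b ^+ 2 by rewrite subr_ge0.
    by field.
  apply/eqP; rewrite -subr_eq0 -sqrf_eq0; apply/eqP/le_anti.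
  rewrite sqr_ge0 andbT; apply/ler_addgt0Pr => e e0; rewrite add0r.
  have y0 := hsq_ge0 y.
  have c0 : 0 < e / (4 * (hsq y + 1)) by rewrite divr_gt0// mulr_gt0// ltr_wpDl.
  have [N1 h1] := small _ c0; have [N2 h2] := hl _ c0.
  have {h1} := h1 (maxn N1 N2) (leq_maxl _ _).
  have {h2} := h2 (maxn N1 N2) (leq_maxr _ _).
  have := step (maxn N1 N2); have := rdot_CS (u (maxn N1 N2) - l) y.
  move: (maxn N1 N2) => n; rewrite !rdotDl rdotNl.
  have ce : e / (4 * (hsq y + 1)) * hsq y <= e / 4.
    have -> : e / 4 = e / (4 * (hsq y + 1)) * hsq y + e / (4 * (hsq y + 1)).
      by field; rewrite gt_eqF// ltr_wpDl.
    by rewrite lerDl ltW.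
  move: (e / (4 * _)) c0 ce => c c0 ce p1 p2 p3 p4.
  have q1 : hsq (u n - l) * hsq y <= c * hsq y by rewrite ler_wpM2r// ltW.
  have q2 : n.+1%:R^-1 * hsq y <= c * hsq y by rewrite ler_wpM2r// ltW.
  move: (n.+1%:R^-1) p1 p2 q2 => b.
  have := sqr_ge0 (rdot (u n) y - rdot l y + (rdot (u n) y - g y)).
  nra.
exists l => y.
have := gE y; have := gE ('i%C *: y).
rewrite /g /rdot fZ hdotZr.
case: (hdot l y) => a b; case: (f y) => a' b' /=.
rewrite !mul0r !mul1r !sub0r => /oppr_inj -> -> //.
Qed.

End HilbertTheory.

Section BoundedOperators.
Variables (R : realType) (H : hilbertType R).
Implicit Types (x y : H).

Record bop := Bop {
  bop_fun :> H -> H;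
  bop_linear : linear bop_fun;
  bop_bounded : exists M : R[i], forall x, `|bop_fun x| <= M * `|x|
}.

Lemma bopP (S T : bop) : (forall x, S x = T x) -> S = T.
Proof.
case: S T => f fl fb [g gl gb] /= /funext fg.
by move: fl fb; rewrite fg => fl fb; congr Bop; apply: Prop_irrelevance.
Qed.

Lemma bop_boundedP (f : H -> H) :
  (exists M : R[i], forall x, `|f x| <= M * `|x|) <->
  (exists2 m : R, 0 <= m & forall x, hsq (f x) <= m * hsq x).
Proof.
split=> [[M hM]|[m m0 hm]].
  exists (complex.Re M ^+ 2); first exact: sqr_ge0.
  move=> x; have := hM x; rewrite !norm_hsq; case: M {hM} => a b.
  rewrite lecE/= !mulr0 subr0 => /andP[_ h].
  rewrite -(sqr_sqrtr (hsq_ge0 (f x))) -(sqr_sqrtr (hsq_ge0 x)) -exprMn.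
  have := sqrtr_ge0 (hsq (f x)); nra.
exists (Num.sqrt m)%:C => x; rewrite !norm_hsq -rmorphM/= lecR -sqrtrM//.
by rewrite ler_sqrt// mulr_ge0 ?hsq_ge0.
Qed.

Lemma bopD (T : bop) x y : T (x + y) = T x + T y.
Proof. by have := bop_linear T 1 x y; rewrite !scale1r. Qed.
Lemma bop0 (T : bop) : T 0 = 0.
Proof. by apply: (addIr (T 0)); rewrite add0r -bopD addr0. Qed.
Lemma bopZ (T : bop) c x : T (c *: x) = c *: T x.
Proof. by have := bop_linear T c x 0; rewrite bop0 !addr0. Qed.

Lemma bop_bound (T : bop) : exists2 M : R[i], 0 <= M & forall x, `|T x| <= M * `|x|.
Proof.
have [M hM] := bop_bounded T; exists `|M| => // x.
have [->|x0] := eqVneq x 0; first by rewrite bop0 !normr0 mulr0.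
apply: le_trans (hM x) _.
have xp : 0 < `|x| by rewrite normr_gt0.
rewrite ler_pM2r//.
have : 0 <= M * `|x| by exact: le_trans (hM x).
by rewrite pmulr_lge0// => M0; rewrite ger0_norm.
Qed.

Fact bop_zero_subproof : linear (fun _ : H => 0 : H) /\
  exists M : R[i], forall x, `|0 : H| <= M * `|x|.
Proof.
split; first by move=> c x y; rewrite scaler0 addr0.
by exists 0 => x; rewrite normr0 mul0r.
Qed.
Definition bop_zero := Bop bop_zero_subproof.1 bop_zero_subproof.2.

Fact bop_one_subproof : linear (@id H) /\
  exists M : R[i], forall x : H, `|x| <= M * `|x|.
Proof. by split=> //; exists 1 => x; rewrite mul1r. Qed.
Definition bop_one := Bop bop_one_subproof.1 bop_one_subproof.2.

Fact bop_add_subproof (S T : bop) : linear (fun x => S x + T x) /\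
  exists M : R[i], forall x, `|S x + T x| <= M * `|x|.
Proof.
split; first by move=> c x y; rewrite !bopD !bopZ scalerDr addrACA.
have [M _ hM] := bop_bound S; have [N _ hN] := bop_bound T.
exists (M + N) => x; rewrite mulrDl.
by apply: le_trans (ler_normD _ _) _; rewrite lerD.
Qed.
Definition bop_add S T := Bop (bop_add_subproof S T).1 (bop_add_subproof S T).2.

Fact bop_scale_subproof c (T : bop) : linear (fun x => c *: T x) /\
  exists M : R[i], forall x, `|c *: T x| <= M * `|x|.
Proof.
split; first by move=> d x y; rewrite !bopD !bopZ scalerDr !scalerA mulrC.
have [M _ hM] := bop_bound T.
by exists (`|c| * M) => x; rewrite normrZ -mulrA ler_wpM2l.
Qed.
Definition bop_scale c T := Bop (bop_scale_subproof c T).1 (bop_scale_subproof c T).2.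

Fact bop_mul_subproof (S T : bop) : linear (fun x => S (T x)) /\
  exists M : R[i], forall x, `|S (T x)| <= M * `|x|.
Proof.
split; first by move=> c x y; rewrite !bopD !bopZ.
have [M M0 hM] := bop_bound S; have [N _ hN] := bop_bound T.
by exists (M * N) => x; apply: le_trans (hM _) _; rewrite -mulrA ler_wpM2l.
Qed.
Definition bop_mul S T := Bop (bop_mul_subproof S T).1 (bop_mul_subproof S T).2.

HB.instance Definition _ := gen_eqMixin bop.
HB.instance Definition _ := gen_choiceMixin bop.

Fact bop_addA : associative bop_add.
Proof. by move=> S T U; apply: bopP => x /=; rewrite addrA. Qed.
Fact bop_addC : commutative bop_add.
Proof. by move=> S T; apply: bopP => x /=; rewrite addrC. Qed.
Fact bop_add0 : left_id bop_zero bop_add.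
Proof. by move=> S; apply: bopP => x /=; rewrite add0r. Qed.
Fact bop_addN : left_inverse bop_zero (bop_scale (-1)) bop_add.
Proof. by move=> S; apply: bopP => x /=; rewrite scaleN1r addNr. Qed.

HB.instance Definition _ := GRing.isZmodule.Build bop
  bop_addA bop_addC bop_add0 bop_addN.

Fact bop_mulA : associative bop_mul.
Proof. by move=> S T U; apply: bopP. Qed.
Fact bop_mul1 : left_id bop_one bop_mul.
Proof. by move=> S; apply: bopP. Qed.
Fact bop_mulr1 : right_id bop_one bop_mul.
Proof. by move=> S; apply: bopP. Qed.
Fact bop_mulDl : left_distributive bop_mul bop_add.
Proof. by move=> S T U; apply: bopP. Qed.
Fact bop_mulDr : right_distributive bop_mul bop_add.
Proof. by move=> S T U; apply: bopP => x /=; rewrite bopD. Qed.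

Fact bop_one_neq0 : bop_one != bop_zero.
Proof.
have [x] := hilbert_nonzero (s := H); apply: contraNneq => /(congr1 bop_fun).
by move=> /(congr1 (@^~ x)) /= ->.
Qed.

HB.instance Definition _ := GRing.Zmodule_isNzRing.Build bop
  bop_mulA bop_mul1 bop_mulr1 bop_mulDl bop_mulDr bop_one_neq0.

Fact bop_scaleA c d T : bop_scale c (bop_scale d T) = bop_scale (c * d) T.
Proof. by apply: bopP => x /=; rewrite scalerA. Qed.
Fact bop_scale1 : left_id 1 bop_scale.
Proof. by move=> T; apply: bopP => x /=; rewrite scale1r. Qed.
Fact bop_scaleDr : right_distributive bop_scale +%R.
Proof. by move=> c S T; apply: bopP => x /=; rewrite scalerDr. Qed.
Fact bop_scaleDl T : {morph bop_scale^~ T : c d / c + d}.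
Proof. by move=> c d; apply: bopP => x /=; rewrite scalerDl. Qed.

HB.instance Definition _ := GRing.Zmodule_isLmodule.Build R[i] bop
  bop_scaleA bop_scale1 bop_scaleDr bop_scaleDl.

Fact bop_scalerAl (c : R[i]) (S T : bop) : c *: (S * T) = (c *: S) * T.
Proof. exact: bopP. Qed.
Fact bop_scalerAr (c : R[i]) (S T : bop) : c *: (S * T) = S * (c *: T).
Proof. by apply: bopP => x /=; rewrite bopZ. Qed.

HB.instance Definition _ := GRing.Lmodule_isLalgebra.Build R[i] bop bop_scalerAl.
HB.instance Definition _ := GRing.Lalgebra_isAlgebra.Build R[i] bop bop_scalerAr.

Lemma bop_adjoint_ex (T : bop) :
  exists S : bop, forall x y, hdot (S x) y = hdot x (T y).
Proof.
have /bop_boundedP[m m0 hm] := bop_bounded T.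
have ex x : exists z, forall y, hdot z y = hdot x (T y).
  apply: (@riesz _ _ (fun y => hdot x (T y)) (hsq x * m)).
    by move=> c y z; rewrite bopD bopZ hdotDr hdotZr.
  move=> y; apply: le_trans (rdot_CS x (T y)) _.
  by rewrite -mulrA ler_wpM2l ?hsq_ge0.
have [f hf] := choice ex.
have fl : linear f.
  move=> c x y; apply: hdot_inj => z.
  by rewrite hf !hdotDl !hdotZl !hf.
have fb : exists M : R[i], forall x, `|f x| <= M * `|x|.
  apply/bop_boundedP; exists m => // x.
  have h : hsq (f x) ^+ 2 <= hsq x * (m * hsq (f x)).
    have -> : hsq (f x) = rdot x (T (f x)) by rewrite /hsq /rdot hf.
    apply: le_trans (rdot_CS x (T (f x))) _.
    have -> : rdot x (T (f x)) = hsq (f x) by rewrite /hsq /rdot hf.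
    by rewrite ler_wpM2l ?hsq_ge0.
  have [->|fn] := eqVneq (hsq (f x)) 0; first by rewrite mulr_ge0 ?hsq_ge0.
  have fp : 0 < hsq (f x) by rewrite lt_neqAle eq_sym fn hsq_ge0.
  by rewrite -(ler_pM2r fp) -expr2 (mulrC m) -mulrA.
by exists (Bop fl fb).
Qed.

Definition bop_adj (T : bop) : bop := projT1 (cid (bop_adjoint_ex T)).

Lemma bop_adjP (T : bop) x y : hdot (bop_adj T x) y = hdot x (T y).
Proof. exact: (projT2 (cid (bop_adjoint_ex T))). Qed.

Lemma bop_adjPr (T : bop) x y : hdot (T x) y = hdot x (bop_adj T y).
Proof. by rewrite hdotC -bop_adjP -hdotC. Qed.

End BoundedOperators.

HB.mixin Record Algebra_isStarAlgebra (R : realType) A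
    of GRing.Algebra R[i] A := {
  star : A -> A;
  starK : involutive star;
  starD : {morph star : x y / x + y};
  starZ : forall (c : R[i]) (x : A), star (c *: x) = c^* *: star x;
  starM : forall x y : A, star (x * y) = star y * star x
}.

#[short(type="starAlgType")]
HB.structure Definition StarAlgebra (R : realType) :=
  {A of GRing.Algebra R[i] A & Algebra_isStarAlgebra R A}.

Section BopStar.
Variables (R : realType) (H : hilbertType R).
Implicit Types S T : bop H.

Fact bop_adjK : involutive (@bop_adj R H).
Proof.
by move=> T; apply: bopP => x; apply: hdot_inj => y; rewrite bop_adjP -bop_adjPr.
Qed.
Fact bop_adjD : {morph (@bop_adj R H) : S T / S + T}.
Proof.
move=> S T; apply: bopP => x; apply: hdot_inj => y.
by rewrite bop_adjP /= hdotDl hdotDr !bop_adjP.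
Qed.
Fact bop_adjZ (c : R[i]) T : bop_adj (c *: T) = c^* *: bop_adj T.
Proof.
apply: bopP => x; apply: hdot_inj => y.
by rewrite bop_adjP /= hdotZl hdotZr conjCK bop_adjP.
Qed.
Fact bop_adjM S T : bop_adj (S * T) = bop_adj T * bop_adj S.
Proof.
apply: bopP => x; apply: hdot_inj => y.
by rewrite bop_adjP /= !bop_adjP.
Qed.

HB.instance Definition _ := Algebra_isStarAlgebra.Build R (bop H)
  bop_adjK bop_adjD bop_adjZ bop_adjM.

Definition vector_state (w : H) : bop H -> R[i] := fun T => hdot w (T w).

End BopStar.

Section MainHypotheses.
Variables (R : realType) (A : starAlgType R).
Implicit Types (phi : A -> R[i]) (a b : nat -> A) (X S : set A).

Definition state phi : Prop :=
  [/\ scalar phi, forall x, 0 <= phi (star x * x) & phi 1 = 1].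

Definition star_subalgebra : set (set A) := [set S |
  [/\ S 1, forall x y, S x -> S y -> S (x + y),
      forall (c : R[i]) x, S x -> S (c *: x),
      forall x y, S x -> S y -> S (x * y)
    & forall x, S x -> S (star x)]].

Definition generated_star_subalgebra X : set A := smallest star_subalgebra X.

(* The index set {1, 2, ...} of the two sequences is shifted to nat.          *)
Record main_hypotheses phi a b (rho : R) (s r : nat -> nat -> R[i]) : Prop := {
  mh_state : state phi;
  mh_selfadjoint : forall i, star (a i) = a i /\ star (b i) = b i;
  mh_centered : forall i, phi (a i) = 0 /\ phi (b i) = 0;
  mh_covariance : - 1 < rho < 1 /\
    forall i, [/\ phi (a i ^+ 2) = 1, phi (b i ^+ 2) = 1
                & phi (a i * b i) = rho%:C];
  mh_moment_bound : exists2 g : nat -> R, (forall n, 0 <= g n) &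
    forall n (i : 'I_n -> nat) (c : 'I_n -> A), (0 < n)%N ->
      (forall j, c j = a (i j) \/ c j = b (i j)) ->
      `|phi (\prod_(j < n) c j)| <= (g n)%:C;
  mh_factorization : forall k (i : 'I_k -> nat) (g : 'I_k -> A), (0 < k)%N ->
      (forall l m : 'I_k, (l < m)%N -> (i l < i m)%N) ->
      (forall m, generated_star_subalgebra [set a (i m); b (i m)] (g m)) ->
      phi (\prod_(m < k) g m) = \prod_(m < k) phi (g m);
  mh_signs : forall i j, (s i j = 1 \/ s i j = -1) /\ (r i j = 1 \/ r i j = -1);
  mh_commutation : forall i j, i != j ->
      [/\ a i * a j = s i j *: (a j * a i),
          b i * b j = s i j *: (b j * b i)
        & a i * b j = r i j *: (b j * a i)]
}.

End MainHypotheses.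

Section TensorProducts.
Variable R : realType.
Local Notation C := R[i].
Local Notation C2 := 'cV[C]_2.

Definition dense_span (H : hilbertType R) (X : set H) : Prop :=
  dense [set u | exists n (c : 'I_n -> C) (x : 'I_n -> H),
                   (forall k, X (x k)) /\ u = \sum_(k < n) c k *: x k].

Definition dot2 (x y : C2) : C := \sum_(k < 2) (x k 0)^* * y k 0.

Definition e0 : C2 := \col_(k < 2) (k == 0)%:R.

Definition stabilized : set (nat -> C2) := [set x | finite_set [set i | x i != e0]].

(* K is the infinite tensor product of copies of (C^2, e0), with x |-> tens x *)
(* sending a stabilized sequence to its elementary tensor; this determines    *)
(* (K, tens) up to a unique unitary. Values of tens outside stabilized are    *)
(* irrelevant. The product below has finitely many factors different from 1.  *)
Record infinite_tensor (K : hilbertType R) (tens : (nat -> C2) -> K) : Prop := {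
  infinite_tensor_dot : forall x y, stabilized x -> stabilized y ->
    hdot (tens x) (tens y) = \big[*%R/1]_(i \in [set: nat]) dot2 (x i) (y i);
  infinite_tensor_span : dense_span [set tens x | x in stabilized]
}.

(* The bounded operator T_0 (x) T_1 (x) ...; the value 0 is taken only when   *)
(* there is no bounded operator acting as prescribed on elementary tensors.   *)
Definition infinite_tensor_op (K : hilbertType R) (tens : (nat -> C2) -> K)
    (T : nat -> 'M[C]_2) : bop K :=
  xget 0 [set S : bop K |
    forall x, stabilized x -> S (tens x) = tens (fun i => T i *m x i)].

Record triple_tensor (K L : hilbertType R) (tens3 : K -> K -> K -> L) : Prop := {
  triple_tensor_dot : forall x y z x' y' z',
    hdot (tens3 x y z) (tens3 x' y' z') = hdot x x' * hdot y y' * hdot z z';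
  triple_tensor_span : dense_span [set w | exists x y z, w = tens3 x y z]
}.

Definition triple_tensor_op (K L : hilbertType R) (tens3 : K -> K -> K -> L)
    (T1 T2 T3 : bop K) : bop L :=
  xget 0 [set S : bop L |
    forall x y z, S (tens3 x y z) = tens3 (T1 x) (T2 y) (T3 z)].

End TensorProducts.

Section Construction.
Variable R : realType.
Local Notation C := R[i].

Definition mx2 (p q u v : C) : 'M[C]_2 :=
  \matrix_(i, j) if i == 0 then (if j == 0 then p else q)
                 else (if j == 0 then u else v).

Definition sigma_mx (x : C) : 'M[C]_2 := mx2 1 0 0 x.
Definition gamma_mx : 'M[C]_2 := mx2 0 1 1 0.
Definition tau_mx (rho : R) : 'M[C]_2 :=
  mx2 rho%:C (Num.sqrt (1 - rho ^+ 2))%:C (Num.sqrt (1 - rho ^+ 2))%:C (- rho%:C).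

(* s is only given above the diagonal; the diagonal value is never used.      *)
Definition symmetrize (s : nat -> nat -> C) (i j : nat) : C :=
  if (i < j)%N then s i j else if (j < i)%N then s j i else 1.

Variables (K : hilbertType R) (tens : (nat -> 'cV[C]_2) -> K).

Definition zeta (s : nat -> nat -> C) (i : nat) : bop K :=
  infinite_tensor_op tens (fun k => if (k < i)%N then sigma_mx (s k i)
                                    else if k == i then gamma_mx else 1%:M).

Definition alpha (i : nat) : bop K :=
  infinite_tensor_op tens (fun k => if k == i then gamma_mx else 1%:M).

Definition beta (s r : nat -> nat -> C) (i : nat) : bop K :=
  infinite_tensor_op tens
    (fun k => if k == i then gamma_mx else sigma_mx (s k i * r k i)).

Definition eta (rho : R) (i : nat) : bop K :=
  infinite_tensor_op tens (fun k => if k == i then tau_mx rho else 1%:M).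

Definition theta (i : nat) : bop K :=
  infinite_tensor_op tens (fun _ => 1%:M).

End Construction.

(* Main.v *)
(** All the 2x2 matrices involved are selfadjoint unitaries, so each prescribed
    action on elementary tensors preserves inner products and therefore extends
    to a bounded operator that is a selfadjoint involution (a reflection). The
    algebraic identities are then checked on elementary tensors, site by site.
    For the factorization property, every element of the star-algebra generated
    by a_i and b_i is a linear combination of product operators whose matrices
    at the sites other than i fix the vacuum vector e0, as do their adjoints. In
    a vacuum expectation such factors disappear, so operators attached to
    disjoint sets of sites are independent. The moments are bounded by 1 because
    reflections are isometries. *)

Require Import Defs.
From mathcomp Require Import all_boot all_order all_algebra.
From mathcomp Require Import complex.
From mathcomp Require Import all_classical all_reals all_analysis.
From mathcomp Require Import ring lra zify.
Import Order.TTheory GRing.Theory Num.Theory.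
Import numFieldNormedType.Exports.
Local Open Scope complex_scope.
Local Open Scope ring_scope.

Set Implicit Arguments.
Unset Strict Implicit.
Unset Printing Implicit Defensive.

(** * Hilbert spaces *)

Section HilbertExtension.
Variable R : realType.
Implicit Types H : hilbertType R.

Lemma hdot0l H (x : H) : hdot 0 x = 0.
Proof. by rewrite hdotC hdot0r rmorph0. Qed.

Lemma hsqD_le2 H (x y : H) : hsq (x + y) <= 2 * (hsq x + hsq y).
Proof.
have := hsq_ge0 (x - y); rewrite /hsq !rdotE (rdotC y x).
by move: (rdot _ _) (rdot _ _) (rdot _ _) => p q t; lra.
Qed.

Lemma hsqN H (x : H) : hsq (- x) = hsq x.
Proof. by rewrite /hsq rdotNl rdotNr opprK. Qed.

Lemma hsqB H (x y : H) : hsq (x - y) = hsq (y - x).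
Proof. by rewrite -hsqN opprB. Qed.

Lemma hsq0 H : hsq (0 : H) = 0.
Proof. by rewrite /hsq /rdot hdot0r. Qed.

Lemma hsqZ H (c : R[i]) (x : H) :
  hsq (c *: x) = (complex.Re c ^+ 2 + complex.Im c ^+ 2) * hsq x.
Proof.
have := hdot_hsq (c *: x); rewrite hdotZl hdotZr mulrA hdot_hsq.
case: c => p q; rewrite [(_)^*]/= => /(congr1 (@complex.Re R)) /=.
by move=> <-; ring.
Qed.

Lemma dense_span_approx H (X : set H) : dense_span X ->
  forall u (e : R), 0 < e ->
  exists n (c : 'I_n -> R[i]) (x : 'I_n -> H),
    (forall k, X (x k)) /\ hsq (u - \sum_(k < n) c k *: x k) < e.
Proof.
move=> dX u e e0.
have s0 : 0 < (Num.sqrt e)%:C by rewrite ltcR sqrtr_gt0.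
have [||v [bv [n [c [x [Xx vE]]]]]] := dX (ball u (Num.sqrt e)%:C).
- by exists u; exact: ballxx.
- exact: ball_open.
exists n, c, x; split=> //; rewrite -vE.
move: bv; rewrite -ball_normE /ball_ /= norm_hsq ltcR.
by rewrite ltr_sqrt.
Qed.

(** If [w] were nonzero, some [u] in the span would satisfy [hsq (w - u) < hsq w]; but [u] is
    orthogonal to [w], so Pythagoras gives [hsq (w - u) = hsq w + hsq u]. *)
Lemma dense_span_separates H (X : set H) w : dense_span X ->
  (forall x, X x -> hdot x w = 0) -> w = 0.
Proof.
move=> dX Xw; apply: hsq_eq0; apply/eqP; rewrite eq_le hsq_ge0 andbT.
rewrite leNgt; apply/negP => w0.
have [n [c [x [Xx]]]] := dense_span_approx dX w w0.
set u := \sum_(_ < _) _; apply/negP; rewrite -leNgt.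
have uw : rdot w u = 0.
  suff uw : hdot u w = 0 by rewrite rdotC /rdot uw.
  rewrite /u; elim/big_ind: _ => [|p q hp hq|k _]; first exact: hdot0l.
    by rewrite hdotDl hp hq addr0.
  by rewrite hdotZl Xw ?mulr0.
rewrite /hsq !rdotE (rdotC u w) uw -/(hsq w) -/(hsq u).
by have := hsq_ge0 u; lra.
Qed.

(** * Extending an inner-product-preserving map from a generating family *)

Section Generators.
Variables (H : hilbertType R) (I : Type) (D : set I) (f : I -> H).
Hypothesis f_dense : dense_span [set f i | i in D]%classic.

Lemma hdot_generators_inj (x y : H) :
  (forall i, D i -> hdot (f i) x = hdot (f i) y) -> x = y.
Proof.
move=> xy; apply/eqP; rewrite -subr_eq0; apply/eqP.
apply: (dense_span_separates f_dense) => _ [i Di <-].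
by rewrite hdotDr hdotNr xy ?subrr.
Qed.

(** Passing to adjoints turns the claim into an equality of inner products against generators, so no
    continuity argument is needed. *)
Lemma bop_generators_inj (S T : bop H) :
  (forall i, D i -> S (f i) = T (f i)) -> S = T.
Proof.
move=> ST; apply: (can_inj (@starK R _)).
apply: bopP => y; apply: hdot_generators_inj => i Di.
by rewrite -[star S]/(bop_adj S) -[star T]/(bop_adj T) -!bop_adjPr ST.
Qed.

Variables (L : hilbertType R) (g : I -> L).
Hypothesis fg_dot : forall i j, D i -> D j ->
  hdot (g i) (g j) = hdot (f i) (f j).

(** The extension is first built as a relation: the [f i] may be linearly dependent, so a formula on
    linear combinations is not visibly well defined. *)
Inductive graph_span : H -> L -> Prop :=
| graph_span0 : graph_span 0 0
| graph_span_lin c i u w : D i -> graph_span u w ->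
    graph_span (c *: f i + u) (c *: g i + w).

Lemma graph_span_dot u w u' w' : graph_span u w -> graph_span u' w' ->
  hdot w w' = hdot u u'.
Proof.
move=> + G'; elim=> [|c i {}u {}w Di _ IH]; first by rewrite !hdot0l.
rewrite !hdotDl !hdotZl IH; congr (_ * _ + _).
elim: G' {IH} => [|d j {}u' {}w' Dj _ IH]; first by rewrite !hdot0r.
by rewrite !hdotDr !hdotZr IH fg_dot.
Qed.

Lemma graph_span_add a u w u' w' : graph_span u w -> graph_span u' w' ->
  graph_span (a *: u + u') (a *: w + w').
Proof.
move=> + G'; elim=> [|c i {}u {}w Di _ IH]; first by rewrite !scaler0 !add0r.
by rewrite !scalerDr !scalerA -!addrA; exact: graph_span_lin.
Qed.

Lemma graph_span_sum n (c : 'I_n -> R[i]) (x : 'I_n -> H) :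
  (forall k, [set f i | i in D]%classic (x k)) ->
  exists w, graph_span (\sum_(k < n) c k *: x k) w.
Proof.
elim: n c x => [|n IH] c x Dx; first by exists 0; rewrite big_ord0; left.
rewrite big_ord_recl; have [i Di <-] := Dx ord0.
have [|w hw] := IH (fun k => c (lift ord0 k)) (fun k => x (lift ord0 k)).
  by move=> k.
by exists (c ord0 *: g i + w); right.
Qed.

(* The extension sends u to w when (u, w) lies in the closure of graph_span. *)
Definition closed_graph u w := forall e : R, 0 < e ->
  exists u' w', [/\ graph_span u' w', hsq (u - u') < e & hsq (w - w') < e].

(** Approximate [u] by elements of the span. Their partners in [L] have the same mutual distances,
    hence form a Cauchy sequence, and its limit is [w]. *)
Lemma closed_graph_total u : exists w, closed_graph u w.
Proof.
have ex n : exists p : H * L, graph_span p.1 p.2 /\ hsq (u - p.1) < n.+1%:R^-1.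
  have n0 : 0 < n.+1%:R^-1 :> R by rewrite invr_gt0 ltr0n.
  have [m [c [x [Xx ux]]]] := dense_span_approx f_dense u n0.
  have [w hw] := graph_span_sum c Xx.
  by exists (\sum_(k < m) c k *: x k, w).
have [p hp] := choice ex.
have small (e : R) : 0 < e ->
    exists N, forall n, (N <= n)%N -> hsq (u - (p n).1) < e.
  move=> e0; have [N _ hN] := near_infty_natSinv_lt (PosNum e0).
  by exists N => n Nn; apply: lt_trans (hp n).2 (hN n Nn).
have [w hw] : exists w, forall e : R, 0 < e ->
    exists n0, forall n, (n0 <= n)%N -> hsq ((p n).2 - w) < e.
  apply: hilbert_complete => e e0; have e4 : 0 < e / 4 by rewrite divr_gt0.
  have [N hN] := small _ e4; exists N => n Nn.
  (* The difference of two pairs of the graph is again in the graph, so both of its components have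
     the same [hsq]. *)
  have G := graph_span_add (-1) (hp n).1 (hp N).1.
  have := graph_span_dot G G; rewrite !scaleN1r addrC [- _ + _]addrC.
  rewrite !hdot_hsq => /(congr1 (@complex.Re R)) /= ->.
  have -> : (p N).1 - (p n).1 = (u - (p n).1) + (- (u - (p N).1)).
    by rewrite opprB [RHS]addrC addrA subrK.
  apply: le_lt_trans (hsqD_le2 _ _) _; rewrite hsqN.
  by have := hN N (leqnn _); have := hN n Nn; lra.
exists w => e e0; have [N1 h1] := small e e0; have [N2 h2] := hw e e0.
exists (p (maxn N1 N2)).1, (p (maxn N1 N2)).2; split; first exact: (hp _).1.
- by apply: h1; exact: leq_maxl.
- by rewrite hsqB; apply: h2; exact: leq_maxr.
Qed.

(** The crude constant 4 comes from applying [hsqD_le2] twice; it suffices for boundedness and for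
    uniqueness of the value at [u]. *)
Lemma closed_graph_bound u w : closed_graph u w -> hsq w <= 4 * hsq u.
Proof.
move=> G; apply/ler_addgt0Pr => e e0.
(* The two approximation errors enter with weights 2 and 4, hence the sixth. *)
have e6 : 0 < e / 6 by rewrite divr_gt0.
have [u' [w' [G' hu hw]]] := G _ e6.
have := graph_span_dot G' G'; rewrite !hdot_hsq => /(congr1 (@complex.Re R)) /= uw.
have := hsqD_le2 (w - w') w'; rewrite subrK uw.
have := hsqD_le2 (u' - u) u; rewrite subrK hsqB.
lra.
Qed.

Lemma closed_graph_lin c u w u' w' : closed_graph u w -> closed_graph u' w' ->
  closed_graph (c *: u + u') (c *: w + w').
Proof.
move=> G G' e e0; set m := complex.Re c ^+ 2 + complex.Im c ^+ 2.
have m0 : 0 <= m by rewrite addr_ge0 ?sqr_ge0.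
(* By [hsqD_le2] the total error is at most [2 * (m + 1)] times this tolerance, that is [e / 2]. *)
have e1 : 0 < e / (4 * (m + 1)) by rewrite divr_gt0// mulr_gt0// ltr_wpDl.
have [x [y [Gxy hx hy]]] := G _ e1; have [x' [y' [Gxy' hx' hy']]] := G' _ e1.
have key (H' : hilbertType R) (p q p' q' : H') : hsq (p - q) < e / (4 * (m + 1)) ->
    hsq (p' - q') < e / (4 * (m + 1)) ->
    hsq ((c *: p + p') - (c *: q + q')) < e.
  move=> hp hq; rewrite opprD addrACA -scalerBr.
  apply: le_lt_trans (hsqD_le2 _ _) _; rewrite hsqZ -/m.
  have eE : e = 4 * (m * (e / (4 * (m + 1))) + e / (4 * (m + 1))).
    by field; rewrite gt_eqF// ltr_wpDl.
  move: hp hq eE e1; move: (e / _) => d hp hq eE d0.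
  have := mulr_ge0 m0 (ltW d0); have : m * hsq (p - q) <= m * d.
    by rewrite ler_wpM2l// ltW.
  move: hq eE; move: (m * hsq _) (m * d) (hsq _) => t1 t2 t3; lra.
exists (c *: x + x'), (c *: y + y'); split; [|exact: key|exact: key].
exact: graph_span_add.
Qed.

Lemma isometric_extension : exists S : H -> L,
  [/\ linear S, forall x, hsq (S x) <= 4 * hsq x
    & forall i, D i -> S (f i) = g i].
Proof.
have [S hS] := choice closed_graph_total.
(* The difference of two values lies over 0 in the closed graph, so the bound forces it to
   vanish. *)
have uniq u w w' : closed_graph u w -> closed_graph u w' -> w = w'.
  move=> G G'; apply/eqP; rewrite -subr_eq0 addrC -scaleN1r; apply/eqP/hsq_eq0.
  have := closed_graph_bound (closed_graph_lin (-1) G' G).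
  rewrite !scaleN1r addNr hsq0 mulr0 => h.
  by apply/eqP; rewrite eq_le h hsq_ge0.
exists S; split=> [c x y|x|i Di].
- exact: uniq (hS _) (closed_graph_lin _ (hS _) (hS _)).
- exact: closed_graph_bound.
apply: uniq (hS _) _ => e e0; exists (f i), (g i); split; rewrite ?subrr ?hsq0//.
by have := graph_span_lin 1 Di graph_span0; rewrite !scale1r !addr0.
Qed.

End Generators.

(** Preserving inner products forces every linear relation among the [f i] to hold among the [g i].
    This is the source of existence for all the tensor product operators. *)
Lemma isometric_extension_bop H I (D : set I) (f g : I -> H) :
  dense_span [set f i | i in D]%classic ->
  (forall i j, D i -> D j -> hdot (g i) (g j) = hdot (f i) (f j)) ->
  exists S : bop H, forall i, D i -> S (f i) = g i.
Proof.
move=> fd fg; have [S [Sl Sb Sfg]] := isometric_extension fd fg.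
have Sb' : exists M : R[i], forall x, `|S x| <= M * `|x|.
  by apply/bop_boundedP; exists 4.
by exists (Bop Sl Sb').
Qed.

End HilbertExtension.

(** * Selfadjoint involutions and their moments *)

Section Reflections.
Variables (R : realType) (H : hilbertType R).
Implicit Types (S : bop H) (x y : H).

Definition reflection S := star S = S /\ S * S = 1.

Lemma reflection1 : reflection 1.
Proof.
split; last exact: mulr1.
(* [star 1 = star 1 * star (star 1) = star (star 1 * 1) = 1]. *)
by rewrite -[LHS]mulr1 -[X in _ * X](starK (1 : bop H)) -starM mulr1 starK.
Qed.

Lemma reflection_isometry S : reflection S ->
  forall x y, hdot (S x) (S y) = hdot x y.
Proof.
move=> [Sadj S2] x y; rewrite bop_adjPr -[bop_adj S]/(star S) Sadj.
by rewrite -[S (S y)]/((S * S) y) S2.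
Qed.

Lemma prod_reflections_isometry n (c : 'I_n -> bop H) :
  (forall j, reflection (c j)) ->
  forall x y, hdot ((\prod_(j < n) c j) x) ((\prod_(j < n) c j) y) = hdot x y.
Proof.
move=> rc; elim/big_rec: _ => // j W _ IH x y.
by rewrite -[RHS]IH; exact: (reflection_isometry (rc j)).
Qed.

(** Cauchy-Schwarz for unit vectors: the component of [y] orthogonal to [x] has squared norm
    [1 - |hdot x y|^2]. *)
Lemma norm_hdot_unit x y : hdot x x = 1 -> hdot y y = 1 -> `|hdot x y| <= 1.
Proof.
move=> x1 y1; have : 0 <= hdot (y - hdot x y *: x) (y - hdot x y *: x).
  by rewrite hdot_norm exprn_ge0.
rewrite !(hdotDl, hdotDr, hdotNl, hdotNr, hdotZl, hdotZr) x1 y1 (hdotC x y).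
by rewrite !mulr1 -normCK subrr addr0 subr_ge0 expr_le1.
Qed.

End Reflections.

(** * Operators on the infinite tensor product *)

Section QubitMatrices.
Variable R : realType.
Local Notation C := R[i].
Implicit Types (M N : 'M[C]_2) (x y : 'cV[C]_2).

Definition adjmx M : 'M[C]_2 := (map_mx Num.conj M)^T.

Lemma adjmxM M N : adjmx (M *m N) = adjmx N *m adjmx M.
Proof. by rewrite /adjmx map_mxM trmx_mul. Qed.

Lemma adjmxK M : adjmx (adjmx M) = M.
Proof. by apply/matrixP => i j; rewrite !mxE conjCK. Qed.

Lemma adjmx1 : adjmx 1%:M = 1%:M.
Proof. by rewrite /adjmx map_mx1 trmx1. Qed.

Lemma dot2_adj M x y : dot2 (M *m x) y = dot2 x (adjmx M *m y).
Proof.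
rewrite /dot2 !big_ord_recl !big_ord0 !mxE !big_ord_recl !big_ord0 !mxE.
rewrite !addr0 !rmorphD !rmorphM /=; ring.
Qed.

Lemma dot2_adjr M x y : dot2 x (M *m y) = dot2 (adjmx M *m x) y.
Proof. by rewrite dot2_adj adjmxK. Qed.

Lemma dot2Zr c x y : dot2 x (c *: y) = c * dot2 x y.
Proof. by rewrite /dot2 mulr_sumr; apply: eq_bigr => k _; rewrite mxE mulrCA. Qed.

Lemma dot2_e0 : dot2 (e0 R) (e0 R) = 1.
Proof.
by rewrite /dot2 !big_ord_recl big_ord0 !mxE /= !rmorph_nat mulr1 mulr0 !addr0.
Qed.

(* Equivalently, M is block diagonal with upper left entry 1. *)
Definition fixes_e0 M := M *m e0 R = e0 R /\ adjmx M *m e0 R = e0 R.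

Lemma fixes_e0_1 : fixes_e0 1%:M.
Proof. by rewrite /fixes_e0 adjmx1 mul1mx. Qed.

Lemma fixes_e0_mul M N : fixes_e0 M -> fixes_e0 N -> fixes_e0 (M *m N).
Proof.
by move=> [M1 M2] [N1 N2]; rewrite /fixes_e0 adjmxM -!mulmxA N1 M1 M2 N2.
Qed.

Lemma fixes_e0_adj M : fixes_e0 M -> fixes_e0 (adjmx M).
Proof. by move=> [M1 M2]; split; rewrite ?adjmxK. Qed.

Definition reflection_mx M := adjmx M = M /\ M *m M = 1%:M.

Lemma reflection_mx1 : reflection_mx 1%:M.
Proof. by rewrite /reflection_mx adjmx1 mul1mx. Qed.

Lemma mx2P M N : M 0 0 = N 0 0 -> M 0 1 = N 0 1 -> M 1 0 = N 1 0 ->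
  M 1 1 = N 1 1 -> M = N.
Proof.
move=> e00 e01 e10 e11; apply/matrixP => i j.
have two (k : 'I_2) : k = 0 \/ k = 1.
  by case: k => [[|[|//]] ?]; [left|right]; apply: val_inj.
by case: (two i) => ->; case: (two j) => ->.
Qed.

Lemma mx2_adj p q u v : adjmx (mx2 p q u v) = mx2 p^* u^* q^* v^* :> 'M[C]_2.
Proof. by apply: mx2P; rewrite !mxE. Qed.

Lemma mx2_mul p q u v p' q' u' v' : mx2 p q u v *m mx2 p' q' u' v' =
  mx2 (p * p' + q * u') (p * q' + q * v') (u * p' + v * u') (u * q' + v * v')
  :> 'M[C]_2.
Proof. by apply: mx2P; rewrite !mxE !big_ord_recl big_ord0 !mxE /= addr0. Qed.

Lemma mx2_1 : 1%:M = mx2 1 0 0 1 :> 'M[C]_2.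
Proof. by apply: mx2P; rewrite !mxE. Qed.

Lemma mx2Z c p q u v : c *: mx2 p q u v = mx2 (c * p) (c * q) (c * u) (c * v)
  :> 'M[C]_2.
Proof. by apply: mx2P; rewrite !mxE. Qed.

Lemma dot2_mx2 p q u v : dot2 (e0 R) (mx2 p q u v *m e0 R) = p.
Proof.
rewrite /dot2 !big_ord_recl big_ord0 !mxE !big_ord_recl !big_ord0 !mxE /=.
by rewrite !rmorph_nat !mulr0 !mul0r !mulr1 mul1r !addr0.
Qed.

Definition sign (x : C) := x = 1 \/ x = -1.

Lemma sign_conj (x : C) : sign x -> x^* = x.
Proof. by case=> ->; rewrite ?rmorphN rmorph1. Qed.

Lemma sign_sqr (x : C) : sign x -> x * x = 1.
Proof. by case=> ->; rewrite ?mulrNN mulr1. Qed.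

Lemma signM (x y : C) : sign x -> sign y -> sign (x * y).
Proof. by case=> -> [] ->; rewrite ?mulrNN ?mulr1 ?mul1r; [left|right|right|left]. Qed.

Lemma sigma_fixes_e0 (x : C) : fixes_e0 (sigma_mx x).
Proof.
rewrite /fixes_e0 /sigma_mx mx2_adj !rmorph0 rmorph1.
by split; apply/matrixP => i j; rewrite !mxE !big_ord_recl big_ord0 !mxE;
  case: i => [[|[|]]] //= _; rewrite !(mul1r, mul0r, mulr0, addr0).
Qed.

Lemma sigma_reflection (x : C) : sign x -> reflection_mx (sigma_mx x).
Proof.
move=> sx; rewrite /reflection_mx /sigma_mx mx2_adj mx2_mul mx2_1.
by rewrite (sign_conj sx) !rmorph0 rmorph1 (sign_sqr sx) !(mulr0, mul0r, mulr1, addr0, add0r).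
Qed.

Lemma gamma_reflection : reflection_mx (gamma_mx R).
Proof.
rewrite /reflection_mx /gamma_mx mx2_adj mx2_mul mx2_1.
by rewrite !rmorph0 rmorph1 !(mulr0, mul0r, mulr1, addr0, add0r).
Qed.

Lemma tau_reflection (rho : R) : `|rho| < 1 -> reflection_mx (tau_mx rho).
Proof.
move=> rho1; rewrite /reflection_mx /tau_mx mx2_adj mx2_mul mx2_1.
have conjR (t : R) : (t%:C)^* = t%:C by apply/CrealP; rewrite complex_real.
split; first by congr mx2; rewrite ?conjR// -rmorphN; exact: conjR.
(* The bound on [rho] makes [1 - rho ^+ 2] nonnegative, so the root really squares to it and the
   diagonal of the square of [tau_mx rho] is 1. *)
have sq : (Num.sqrt (1 - rho ^+ 2))%:C * (Num.sqrt (1 - rho ^+ 2))%:C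
          = 1 - rho%:C * rho%:C.
  rewrite -!rmorphM/= -!expr2 sqr_sqrtr ?rmorphB ?rmorph1//.
  by rewrite subr_ge0 -real_normK ?num_real// expr_le1// ltW.
by congr mx2; rewrite ?mulrNN ?sq; ring.
Qed.

(** The source of every sign in the commutation relations: [gamma_mx] swaps the basis vectors while
    [sigma_mx x] scales only the second, so exchanging them costs a factor [x]. *)
Lemma gamma_sigma (x : C) : sign x ->
  gamma_mx R *m sigma_mx x = x *: (sigma_mx x *m gamma_mx R).
Proof.
move=> sx; rewrite /gamma_mx /sigma_mx !mx2_mul mx2Z.
by rewrite !(mulr0, mul0r, mulr1, mul1r, addr0, add0r) (sign_sqr sx).
Qed.

Lemma sigma_gamma (x : C) : sign x ->
  sigma_mx x *m gamma_mx R = x *: (gamma_mx R *m sigma_mx x).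
Proof. by move=> sx; rewrite gamma_sigma// scalerA sign_sqr// scale1r. Qed.

Lemma sigmaC (x y : C) : sigma_mx x *m sigma_mx y = sigma_mx y *m sigma_mx x :> 'M[C]_2.
Proof.
by rewrite /sigma_mx !mx2_mul !(mulr0, mul0r, mulr1, mul1r, addr0, add0r) mulrC.
Qed.

End QubitMatrices.

Lemma finite_set_bound (D : set nat) : finite_set D ->
  exists N, forall k, (N <= k)%N -> ~ D k.
Proof.
move=> /finite_seqP[t ->]; exists (\max_(i <- t) i).+1 => k Nk /= kt.
by have := leq_trans Nk (leq_bigmax_seq (F := fun i => i) k kt isT); rewrite ltnn.
Qed.

Lemma fsbig_bound (A : comPzSemiRingType) N (F : nat -> A) :
  (forall k, (N <= k)%N -> F k = 1) ->
  \big[*%R/1]_(i \in [set: nat]) F i = \prod_(k < N) F k.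
Proof.
move=> F1; rewrite fsbig_ord; apply/esym/fsbig_widen => // k /= [_ /negP].
by rewrite -leqNgt; exact: F1.
Qed.

(** * Product operators, locality and vacuum expectations *)

Section InfiniteTensor.
Variable R : realType.
Local Notation C := R[i].
Local Notation e0 := (e0 R).
Variables (K : hilbertType R) (tens : (nat -> 'cV[C]_2) -> K).
Hypothesis K_tensor : infinite_tensor tens.
Implicit Types (S : bop K) (T U : nat -> 'M[C]_2) (D : set nat).

Let v := tens (fun=> e0).

Lemma stabilizedP (x : nat -> 'cV[C]_2) :
  stabilized x <-> exists N, forall k, (N <= k)%N -> x k = e0.
Proof.
split=> [/finite_set_bound[N hN]|[N hN]].
  by exists N => k /hN/= /negP; rewrite negbK => /eqP.
apply: (sub_finite_set _ (finite_II N)) => k /= xk.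
by rewrite ltnNge; apply: contra xk => /hN ->.
Qed.

Lemma stabilized_e0 : stabilized (fun=> e0).
Proof. by apply/stabilizedP; exists 0%N. Qed.

(** [D] holds the sites where the vacuum may be moved. Elsewhere the matrices need not be the
    identity, which accommodates the infinite tail of sigmas in [beta]; for finite [D] stabilized
    sequences stay stabilized. *)
Definition local_mx D T := forall k, ~ D k -> fixes_e0 (T k).

Lemma stabilized_local D T x : finite_set D -> local_mx D T ->
  stabilized x -> stabilized (fun k => T k *m x k).
Proof.
move=> /finite_set_bound[N hN] lT /stabilizedP[N' hx].
apply/stabilizedP; exists (maxn N N') => k; rewrite geq_max => /andP[Nk N'k].
by rewrite hx//; apply: (lT _ (hN _ Nk)).1.
Qed.

(** Stated for all large [N], so that several inner products can be expanded over one common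
    range. *)
Lemma tens_dot_bound x y : stabilized x -> stabilized y ->
  exists N0, forall N, (N0 <= N)%N ->
  hdot (tens x) (tens y) = \prod_(k < N) dot2 (x k) (y k).
Proof.
move=> sx sy; have /stabilizedP[N hN] := sx; have /stabilizedP[N' hN'] := sy.
exists (maxn N N') => M; rewrite geq_max => /andP[NM N'M].
rewrite (infinite_tensor_dot K_tensor)//; apply: fsbig_bound => // k Mk.
by rewrite hN ?hN' ?dot2_e0// (leq_trans _ Mk).
Qed.

Lemma tens_dot_eq x y x' y' :
  stabilized x -> stabilized y -> stabilized x' -> stabilized y' ->
  (forall k, dot2 (x k) (y k) = dot2 (x' k) (y' k)) ->
  hdot (tens x) (tens y) = hdot (tens x') (tens y').
Proof.
move=> sx sy sx' sy' xy; rewrite !(infinite_tensor_dot K_tensor)//.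
by apply: eq_fsbigr => k _.
Qed.

Lemma hdot_vacuum : hdot v v = 1.
Proof.
rewrite (infinite_tensor_dot K_tensor); try exact: stabilized_e0.
by apply: fsbig1 => k _; rewrite dot2_e0.
Qed.

Definition acts_as S T :=
  forall x, stabilized x -> S (tens x) = tens (fun k => T k *m x k).

Lemma acts_as_mul S S' T T' D : finite_set D -> local_mx D T' ->
  acts_as S T -> acts_as S' T' -> acts_as (S * S') (fun k => T k *m T' k).
Proof.
move=> fD lT ST ST' x sx; rewrite [LHS]/= ST'// ST; last exact: stabilized_local fD lT sx.
by congr tens; apply/funext => k; rewrite mulmxA.
Qed.

(** Against elementary tensors the adjoint can be moved across the inner product one factor at a
    time. *)
Lemma acts_as_star S T D : finite_set D -> local_mx D T ->
  acts_as S T -> acts_as (star S) (fun k => adjmx (T k)).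
Proof.
move=> fD lT ST x sx; apply: (hdot_generators_inj (infinite_tensor_span K_tensor)).
move=> y sy; rewrite -[star S]/(bop_adj S) -bop_adjPr ST//.
have lT' : local_mx D (fun k => adjmx (T k)) by move=> k /lT; exact: fixes_e0_adj.
apply: tens_dot_eq => //; [exact: (stabilized_local fD)|exact: (stabilized_local fD)|].
by move=> k; rewrite dot2_adj.
Qed.

Lemma acts_as_inj S S' T : acts_as S T -> acts_as S' T -> S = S'.
Proof.
move=> ST ST'; apply: (bop_generators_inj (infinite_tensor_span K_tensor)) => x sx.
by rewrite ST// ST'.
Qed.

Lemma acts_as1 : acts_as 1 (fun=> 1%:M).
Proof. by move=> x _; congr tens; apply/funext => k; rewrite mul1mx. Qed.

Lemma acts_as_expectation S T D : finite_set D -> local_mx D T -> acts_as S T ->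
  exists N0, forall N, (N0 <= N)%N ->
  hdot v (S v) = \prod_(k < N) dot2 e0 (T k *m e0).
Proof.
move=> fD lT ST; rewrite /v (ST _ stabilized_e0).
apply: (tens_dot_bound stabilized_e0).
exact: (stabilized_local fD lT stabilized_e0).
Qed.

Definition local_op D S := exists2 T, acts_as S T & local_mx D T.

Lemma local_op_mul D D' S S' : finite_set D' ->
  local_op D S -> local_op D' S' -> local_op (D `|` D')%classic (S * S').
Proof.
move=> fD' [T ST lT] [T' ST' lT']; exists (fun k => T k *m T' k).
  exact: (acts_as_mul fD' lT' ST ST').
by move=> k /not_orP[kD kD']; apply: fixes_e0_mul; [exact: lT|exact: lT'].
Qed.

Lemma local_op_star D S : finite_set D -> local_op D S -> local_op D (star S).
Proof.
move=> fD [T ST lT]; exists (fun k => adjmx (T k)); first exact: (acts_as_star fD lT ST).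
by move=> k /lT; exact: fixes_e0_adj.
Qed.

Lemma local_op1 D : local_op D 1.
Proof. by exists (fun=> 1%:M); [exact: acts_as1|move=> k _; exact: fixes_e0_1]. Qed.

(** At a site in [D] the matrix of [S'] fixes [e0] and drops out. At any other site the matrix of
    [S], moved to the left as its adjoint, fixes [e0] there. The expectation thus splits site by
    site. *)
Lemma local_op_independent D D' S S' : finite_set D -> finite_set D' ->
  (forall k, D k -> ~ D' k) -> local_op D S -> local_op D' S' ->
  hdot v ((S * S') v) = hdot v (S v) * hdot v (S' v).
Proof.
move=> fD fD' DD' [T ST lT] [T' ST' lT'].
have lTT' : local_mx (D `|` D')%classic (fun k => T k *m T' k).
  by move=> k /not_orP[kD kD']; apply: fixes_e0_mul; [exact: lT|exact: lT'].
have fDD' : finite_set (D `|` D')%classic by rewrite finite_setU.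
have [N hN] := acts_as_expectation fDD' lTT' (acts_as_mul fD' lT' ST ST').
have [N1 hN1] := acts_as_expectation fD lT ST.
have [N2 hN2] := acts_as_expectation fD' lT' ST'.
pose M := maxn N (maxn N1 N2).
rewrite (hN M) ?leq_maxl// (hN1 M) ?(hN2 M) ?/M; try lia.
rewrite -big_split; apply: eq_bigr => k _ /=; rewrite -mulmxA.
have [kD|kD] := pselect (D k).
  by have [-> _] := lT' _ (DD' _ kD); rewrite dot2_e0 mulr1.
by have [TE TE'] := lT _ kD; rewrite dot2_adjr TE' TE dot2_e0 mul1r.
Qed.

Lemma acts_as_single S T i : local_mx [set i]%classic T -> acts_as S T ->
  hdot v (S v) = dot2 e0 (T i *m e0).
Proof.
move=> lT ST; have [N hN] := acts_as_expectation (finite_set1 i) lT ST.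
rewrite (hN (maxn N i.+1)) ?leq_maxl//.
have iM : (i < maxn N i.+1)%N by rewrite leq_max ltnSn orbT.
rewrite (bigD1 (Ordinal iM))//= big1 ?mulr1// => k.
rewrite -val_eqE /= => /eqP ki.
by have [-> _] := lT k ki; rewrite dot2_e0.
Qed.

(** The map [tens] is known only through its inner products, so the scalars are extracted from the
    factors of an inner product; only those at [i] and [j] can differ from 1. *)
Lemma acts_as_scale S S' T T' D (c : nat -> C) i j : finite_set D ->
  local_mx D T -> local_mx D T' -> acts_as S T -> acts_as S' T' -> i != j ->
  (forall k, k != i -> k != j -> c k = 1) ->
  (forall k, T k = c k *: T' k) -> S = (c i * c j) *: S'.
Proof.
move=> fD lT lT' ST ST' ij c1 TT'.
apply: (bop_generators_inj (infinite_tensor_span K_tensor)) => x sx.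
apply: (hdot_generators_inj (infinite_tensor_span K_tensor)) => y sy.
rewrite [in RHS]/= hdotZr ST// ST'//.
have sT := stabilized_local fD lT sx; have sT' := stabilized_local fD lT' sx.
have [N hN] := tens_dot_bound sy sT; have [N' hN'] := tens_dot_bound sy sT'.
pose M := maxn (maxn N N') (maxn i.+1 j.+1).
rewrite (hN M) ?(hN' M) ?/M; try lia.
under eq_bigr do rewrite TT' -scalemxAl dot2Zr.
rewrite big_split /=; congr (_ * _).
have iM : (i < M)%N by rewrite /M; lia.
have jM : (j < M)%N by rewrite /M; lia.
rewrite (bigD1 (Ordinal iM))//= (bigD1 (Ordinal jM))/=; last first.
  by rewrite -val_eqE /= eq_sym.
by rewrite big1 ?mulr1// => k /andP[ki kj]; apply: c1; rewrite -?val_eqE.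
Qed.

Section ReflectionFamily.
Variables (D : set nat) (T : nat -> 'M[C]_2).
Hypotheses (fin_D : finite_set D) (T_local : local_mx D T)
  (T_reflection : forall k, reflection_mx (T k)).

Lemma infinite_tensor_op_acts : acts_as (infinite_tensor_op tens T) T.
Proof.
(* Once some operator acts as prescribed, [xget] returns such an operator instead of the default 0.
   Existence holds because reflection matrices preserve each factor [dot2]. *)
apply: (@xgetPex _ 0 [set S : bop K | acts_as S T]%classic).
apply: (isometric_extension_bop (infinite_tensor_span K_tensor)) => x y sx sy.
apply: tens_dot_eq => //; try exact: (stabilized_local fin_D).
by move=> k; have [Tadj T2] := T_reflection k; rewrite dot2_adj Tadj mulmxA T2 mul1mx.
Qed.

Lemma infinite_tensor_op_reflection : reflection (infinite_tensor_op tens T).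
Proof.
have A := infinite_tensor_op_acts; split.
  apply: (acts_as_inj (acts_as_star fin_D T_local A)).
  by move=> x sx; rewrite A//; congr tens; apply/funext => k; rewrite (T_reflection k).1.
apply: (acts_as_inj (acts_as_mul fin_D T_local A A)).
by move=> x sx; congr tens; apply/funext => k; rewrite (T_reflection k).2 mul1mx.
Qed.

End ReflectionFamily.

(** Reduces commutation up to a sign to a check at each site; both products are compared as product
    operators local to the union of [D] and [D']. *)
Lemma infinite_tensor_op_commute D D' T U (c : nat -> C) i j :
  finite_set D -> local_mx D T -> (forall k, reflection_mx (T k)) ->
  finite_set D' -> local_mx D' U -> (forall k, reflection_mx (U k)) ->
  i != j -> (forall k, k != i -> k != j -> c k = 1) ->
  (forall k, T k *m U k = c k *: (U k *m T k)) ->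
  infinite_tensor_op tens T * infinite_tensor_op tens U =
  (c i * c j) *: (infinite_tensor_op tens U * infinite_tensor_op tens T).
Proof.
move=> fD lT rT fD' lU rU ij c1 TU.
have AT := infinite_tensor_op_acts fD lT rT.
have AU := infinite_tensor_op_acts fD' lU rU.
have lm T1 T2 : local_mx (D `|` D')%classic T1 -> local_mx (D `|` D')%classic T2 ->
    local_mx (D `|` D')%classic (fun k => T1 k *m T2 k).
  by move=> l1 l2 k kD; apply: fixes_e0_mul; [exact: l1|exact: l2].
have lT' : local_mx (D `|` D')%classic T by move=> k /not_orP[kD _]; exact: lT.
have lU' : local_mx (D `|` D')%classic U by move=> k /not_orP[_ kD]; exact: lU.
apply: (acts_as_scale _ (lm _ _ lT' lU') (lm _ _ lU' lT')
  (acts_as_mul fD' lU AT AU) (acts_as_mul fD lT AU AT) ij c1 TU).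
by rewrite finite_setU.
Qed.

End InfiniteTensor.

(** * Operators on the threefold tensor product *)

Section TripleTensor.
Variable R : realType.
Local Notation C := R[i].
Variables (K L : hilbertType R) (tens3 : K -> K -> K -> L).
Hypothesis L_tensor : triple_tensor tens3.
Implicit Types (S T : bop K) (W : bop L).

(** Uncurried form of [tens3], indexed by one type as the lemmas on generating families require. *)
Let elem (p : K * K * K) := tens3 p.1.1 p.1.2 p.2.

Lemma triple_tensor_dense : dense_span [set elem p | p in [set: K * K * K]]%classic.
Proof.
have -> : [set elem p | p in [set: K * K * K]]%classic =
    [set w | exists x y z, w = tens3 x y z]%classic.
  apply/seteqP; split=> w /=; first by move=> [[[x y] z] _ <-]; exists x, y, z.
  by move=> [x [y [z ->]]]; exists (x, y, z).
exact: triple_tensor_span.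
Qed.

(** Homogeneity is a consequence of the inner product formula, because elementary tensors separate
    vectors. *)
Lemma tens3Z a b c x y z :
  tens3 (a *: x) (b *: y) (c *: z) = (a * b * c) *: tens3 x y z.
Proof.
apply: (hdot_generators_inj triple_tensor_dense) => -[[x' y'] z'] _.
by rewrite /elem /= hdotZr !(triple_tensor_dot L_tensor) !hdotZr; ring.
Qed.

Definition acts_as3 W S1 S2 S3 :=
  forall x y z, W (tens3 x y z) = tens3 (S1 x) (S2 y) (S3 z).

Lemma acts_as3_inj W W' S1 S2 S3 :
  acts_as3 W S1 S2 S3 -> acts_as3 W' S1 S2 S3 -> W = W'.
Proof.
move=> A A'; apply: (bop_generators_inj triple_tensor_dense) => -[[x y] z] _.
by rewrite /elem A A'.
Qed.

Lemma acts_as3_mul W W' S1 S2 S3 T1 T2 T3 : acts_as3 W S1 S2 S3 ->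
  acts_as3 W' T1 T2 T3 -> acts_as3 (W * W') (S1 * T1) (S2 * T2) (S3 * T3).
Proof. by move=> A A' x y z; rewrite [LHS]/= A' A. Qed.

Lemma acts_as3_1 : acts_as3 1 1 1 1.
Proof. by []. Qed.

Lemma acts_as3_scale W a b c S1 S2 S3 : acts_as3 W S1 S2 S3 ->
  acts_as3 ((a * b * c) *: W) (a *: S1) (b *: S2) (c *: S3).
Proof. by move=> A x y z; rewrite [RHS]tens3Z /= A. Qed.

Lemma acts_as3_star W S1 S2 S3 :
  acts_as3 W S1 S2 S3 -> acts_as3 (star W) (star S1) (star S2) (star S3).
Proof.
move=> A x y z; apply: (hdot_generators_inj triple_tensor_dense) => -[[x' y'] z'] _.
rewrite /elem /= -[star W]/(bop_adj W) -bop_adjPr A !(triple_tensor_dot L_tensor).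
by rewrite !bop_adjPr.
Qed.

Section Reflections.
Variables S1 S2 S3 : bop K.
Hypotheses (r1 : reflection S1) (r2 : reflection S2) (r3 : reflection S3).

Lemma triple_tensor_op_acts : acts_as3 (triple_tensor_op tens3 S1 S2 S3) S1 S2 S3.
Proof.
apply: (@xgetPex _ 0 [set W : bop L | acts_as3 W S1 S2 S3]%classic).
have [|W hW] := @isometric_extension_bop R L _ _ elem
  (fun p => tens3 (S1 p.1.1) (S2 p.1.2) (S3 p.2)) triple_tensor_dense.
  by move=> p q _ _; rewrite !(triple_tensor_dot L_tensor) !reflection_isometry.
by exists W => x y z; exact: (hW (x, y, z)).
Qed.

Lemma triple_tensor_op_reflection : reflection (triple_tensor_op tens3 S1 S2 S3).
Proof.
have A := triple_tensor_op_acts; split.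
  apply: acts_as3_inj (acts_as3_star A) _.
  by rewrite r1.1 r2.1 r3.1; exact: A.
apply: acts_as3_inj (acts_as3_mul A A) _.
by rewrite r1.2 r2.2 r3.2; exact: acts_as3_1.
Qed.

End Reflections.

Lemma triple_tensor_op_commute S1 S2 S3 T1 T2 T3 a b c :
  reflection S1 -> reflection S2 -> reflection S3 ->
  reflection T1 -> reflection T2 -> reflection T3 ->
  S1 * T1 = a *: (T1 * S1) -> S2 * T2 = b *: (T2 * S2) -> S3 * T3 = c *: (T3 * S3) ->
  triple_tensor_op tens3 S1 S2 S3 * triple_tensor_op tens3 T1 T2 T3 =
  (a * b * c) *: (triple_tensor_op tens3 T1 T2 T3 * triple_tensor_op tens3 S1 S2 S3).
Proof.
move=> s1 s2 s3 t1 t2 t3 ST1 ST2 ST3.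
have AS := triple_tensor_op_acts s1 s2 s3; have AT := triple_tensor_op_acts t1 t2 t3.
apply: acts_as3_inj (acts_as3_mul AS AT) _.
by rewrite ST1 ST2 ST3; apply: acts_as3_scale; exact: acts_as3_mul.
Qed.

(** * The vacuum state: independence over disjoint sites and moment bounds *)

Section Vacuum.
Variables (tens : (nat -> 'cV[C]_2) -> K).
Hypothesis K_tensor : infinite_tensor tens.
Let v := tens (fun=> e0 R).
Let phi := vector_state (tens3 v v v).
Implicit Types D : set nat.

Lemma vacuum_dot : hdot (tens3 v v v) (tens3 v v v) = 1.
Proof. by rewrite (triple_tensor_dot L_tensor) (hdot_vacuum K_tensor) !mulr1. Qed.

Lemma vacuum_state : state phi.
Proof.
split=> [c S T|S|]; rewrite /phi /vector_state /=.
- by rewrite hdotDr hdotZr.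
- by rewrite -[star S]/(bop_adj S) -bop_adjPr hdot_norm exprn_ge0.
- exact: vacuum_dot.
Qed.

Lemma vacuum_acts W S1 S2 S3 : acts_as3 W S1 S2 S3 ->
  phi W = hdot v (S1 v) * hdot v (S2 v) * hdot v (S3 v).
Proof. by move=> A; rewrite /phi /vector_state A (triple_tensor_dot L_tensor). Qed.

Definition local_op3 D W := exists S1 S2 S3,
  [/\ acts_as3 W S1 S2 S3, local_op tens D S1, local_op tens D S2 & local_op tens D S3].

Lemma local_op3_mul D D' W W' : finite_set D' ->
  local_op3 D W -> local_op3 D' W' -> local_op3 (D `|` D')%classic (W * W').
Proof.
move=> fD' [S1 [S2 [S3 [A l1 l2 l3]]]] [T1 [T2 [T3 [A' l1' l2' l3']]]].
exists (S1 * T1), (S2 * T2), (S3 * T3); split; try exact: local_op_mul.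
exact: acts_as3_mul.
Qed.

Lemma local_op3_star D W : finite_set D -> local_op3 D W -> local_op3 D (star W).
Proof.
move=> fD [S1 [S2 [S3 [A l1 l2 l3]]]].
exists (star S1), (star S2), (star S3); split; try exact: (local_op_star K_tensor).
exact: acts_as3_star.
Qed.

Lemma local_op3_independent D D' W W' : finite_set D -> finite_set D' ->
  (forall k, D k -> ~ D' k) -> local_op3 D W -> local_op3 D' W' ->
  phi (W * W') = phi W * phi W'.
Proof.
move=> fD fD' DD' [S1 [S2 [S3 [A l1 l2 l3]]]] [T1 [T2 [T3 [A' l1' l2' l3']]]].
rewrite (vacuum_acts (acts_as3_mul A A')) (vacuum_acts A) (vacuum_acts A').
have ind := local_op_independent K_tensor fD fD' DD'.
by rewrite (ind _ _ l1 l1') (ind _ _ l2 l2') (ind _ _ l3 l3'); ring.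
Qed.

(** Linear combinations of local product operators, presented inductively so that bilinear
    statements follow by induction on each argument. *)
Inductive local_span D : bop L -> Prop :=
| local_span0 : local_span D 0
| local_span_lin c W W' : local_op3 D W -> local_span D W' ->
    local_span D (c *: W + W').

Lemma local_span_of D W : local_op3 D W -> local_span D W.
Proof. by move=> lW; rewrite -[W]scale1r -[_ *: _]addr0; right=> //; left. Qed.

Lemma local_span1 D : local_span D 1.
Proof.
apply: local_span_of; exists 1, 1, 1.
by split; [exact: acts_as3_1|exact: local_op1..].
Qed.

Lemma local_spanD D W W' : local_span D W -> local_span D W' -> local_span D (W + W').
Proof.
move=> + lW'; elim=> [|c {}W W1 lW _ IH]; first by rewrite add0r.
by rewrite -addrA; right.
Qed.

Lemma local_spanZ D c W : local_span D W -> local_span D (c *: W).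
Proof.
elim=> [|d {}W W1 lW _ IH]; first by rewrite scaler0; left.
by rewrite scalerDr scalerA; right.
Qed.

Lemma local_span_star D W : finite_set D -> local_span D W -> local_span D (star W).
Proof.
move=> fD; have star0 : star (0 : bop L) = 0.
  by rewrite -[X in star X](scale0r 0) starZ rmorph0 scale0r.
elim=> [|d {}W W1 lW _ IH]; first by rewrite star0; left.
by rewrite starD starZ; right => //; exact: local_op3_star.
Qed.

Lemma local_spanM D D' W W' : finite_set D' ->
  local_span D W -> local_span D' W' -> local_span (D `|` D')%classic (W * W').
Proof.
move=> fD' lW lW'; elim: lW => [|c {}W W1 lW _ IH]; first by rewrite mul0r; left.
rewrite mulrDl; apply: local_spanD => {IH} //; rewrite -scalerAl; apply: local_spanZ.
elim: lW' => [|d {}W' W2 lW' _ IH]; first by rewrite mulr0; left.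
by rewrite mulrDr -scalerAr; right=> //; exact: local_op3_mul.
Qed.

Lemma phi_lin c W W' : phi (c *: W + W') = c * phi W + phi W'.
Proof. by case: vacuum_state => + _ _; exact. Qed.

Lemma phi0 : phi 0 = 0.
Proof. by rewrite /phi /vector_state /= hdot0r. Qed.

Lemma local_span_independent D D' W W' : finite_set D -> finite_set D' ->
  (forall k, D k -> ~ D' k) -> local_span D W -> local_span D' W' ->
  phi (W * W') = phi W * phi W'.
Proof.
move=> fD fD' DD' lW lW'; elim: lW => [|c {}W W1 lW _ IH].
  by rewrite mul0r phi0 mul0r.
rewrite mulrDl -scalerAl !phi_lin IH mulrDl -mulrA; congr (_ * _ + _) => {IH}.
elim: lW' => [|d {}W' W2 lW' _ IH]; first by rewrite mulr0 phi0 mulr0.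
rewrite mulrDr -scalerAr !phi_lin IH mulrDr mulrCA; congr (_ * _ + _).
exact: local_op3_independent lW lW'.
Qed.

(** [local_span D] is itself a unital star-subalgebra, closed under products since the union of [D]
    with itself is [D]; hence it contains the smallest one over [X]. *)
Lemma generated_local D (X : set (bop L)) W : finite_set D ->
  (forall V, X V -> local_op3 D V) -> generated_star_subalgebra X W -> local_span D W.
Proof.
move=> fD XD; apply; split; last by move=> V /XD; exact: local_span_of.
split; [exact: local_span1|exact: local_spanD|exact: local_spanZ| |].
- by move=> V V' lV lV'; rewrite -[D]setUid; exact: local_spanM.
- by move=> V; exact: local_span_star.
Qed.

Lemma phi_prod_independent n (i : 'I_n -> nat) (g : 'I_n -> bop L) : injective i ->
  (forall m, local_span [set i m]%classic (g m)) ->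
  phi (\prod_(m < n) g m) = \prod_(m < n) phi (g m).
Proof.
move=> inj_i lg.
(* The induction also records that the product lives on the sites used so far; injectivity of [i]
   keeps the last site apart from them. *)
suff [//] : local_span (range i) (\prod_(m < n) g m) /\
  phi (\prod_(m < n) g m) = \prod_(m < n) phi (g m).
elim: n i g inj_i lg => [|n IH] i g inj_i lg.
  by rewrite !big_ord0; split; [exact: local_span1|case: vacuum_state].
rewrite !big_ord_recr /=; set w := widen_ord _.
have inj_w : injective (i \o w) by move=> x y /inj_i /(congr1 val) /= /val_inj.
have [/= lP eP] := IH (i \o w) (g \o w) inj_w (fun m => lg (w m)).
have fr m (f : 'I_m -> nat) : finite_set (range f) by exact: finite_image.
split; last first.
  rewrite -eP; apply: local_span_independent (fr _ (i \o w)) (finite_set1 (i ord_max)) _ lP _ => //.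
  move=> _ [m _ <-] /= /inj_i /(congr1 val) /= mn.
  by have := ltn_ord m; rewrite mn ltnn.
have -> : range i = (range (i \o w) `|` [set i ord_max])%classic.
  apply/seteqP; split=> k /=; last first.
    by move=> [[m _ <-]|->]; [exists (w m)|exists ord_max].
  move=> [m _ <-]; have [mn|] := ltnP m n.
    by left; exists (Ordinal mn) => //=; congr i; exact: val_inj.
  move=> nm; right; congr i; apply: val_inj => /=.
  by apply/eqP; rewrite eqn_leq nm -ltnS ltn_ord.
exact: local_spanM.
Qed.

(** A product of reflections is an isometry, so the moment is an inner product of two unit
    vectors. *)
Lemma phi_prod_reflections n (c : 'I_n -> bop L) :
  (forall j, reflection (c j)) -> `|phi (\prod_(j < n) c j)| <= 1.
Proof.
move=> rc; apply: norm_hdot_unit; first exact: vacuum_dot.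
by rewrite prod_reflections_isometry// vacuum_dot.
Qed.

End Vacuum.
End TripleTensor.

(** * The operators of the model *)

Lemma symmetrize_sign (R : realType) (s : nat -> nat -> R[i]) i j :
  (forall k l, (k < l)%N -> sign (s k l)) -> sign (symmetrize s i j).
Proof.
by move=> ss; rewrite /symmetrize; case: ltnP => [/ss//|_]; case: ltnP => [/ss//|_]; left.
Qed.

Lemma symmetrizeC (R : realType) (s : nat -> nat -> R[i]) i j :
  symmetrize s i j = symmetrize s j i.
Proof. by rewrite /symmetrize; case: ltngtP. Qed.

(** * Site matrices, vacuum expectations and commutation signs *)

Section SiteMatrices.
Variables (R : realType) (rho : R) (rho_lt1 : `|rho| < 1).
Variables (s r : nat -> nat -> R[i]).
Hypotheses (s_sign : forall i j, sign (s i j)) (r_sign : forall i j, sign (r i j)).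
Hypotheses (s_sym : forall i j, s i j = s j i) (r_sym : forall i j, r i j = r j i).

(** In this and the next three families the first index is that of the operator and the second is
    the tensor site. *)
Definition zeta_mx (i k : nat) : 'M[R[i]]_2 :=
  if (k < i)%N then sigma_mx (s k i) else if k == i then gamma_mx R else 1%:M.
Definition alpha_mx (i k : nat) : 'M[R[i]]_2 := if k == i then gamma_mx R else 1%:M.
Definition beta_mx (i k : nat) : 'M[R[i]]_2 :=
  if k == i then gamma_mx R else sigma_mx (s k i * r k i).
Definition eta_mx (i k : nat) : 'M[R[i]]_2 := if k == i then tau_mx rho else 1%:M.

Lemma zeta_mx_local i : local_mx [set i]%classic (zeta_mx i).
Proof.
move=> k /= /eqP/negPf ki; rewrite /zeta_mx ki.
by case: ifP => _; [exact: sigma_fixes_e0|exact: fixes_e0_1].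
Qed.

Lemma alpha_mx_local i : local_mx [set i]%classic (alpha_mx i).
Proof. by move=> k /= /eqP/negPf ki; rewrite /alpha_mx ki; exact: fixes_e0_1. Qed.

Lemma beta_mx_local i : local_mx [set i]%classic (beta_mx i).
Proof. by move=> k /= /eqP/negPf ki; rewrite /beta_mx ki; exact: sigma_fixes_e0. Qed.

Lemma eta_mx_local i : local_mx [set i]%classic (eta_mx i).
Proof. by move=> k /= /eqP/negPf ki; rewrite /eta_mx ki; exact: fixes_e0_1. Qed.

Lemma theta_mx_local i : local_mx [set i]%classic (fun=> 1%:M : 'M[R[i]]_2).
Proof. by move=> k _; exact: fixes_e0_1. Qed.

Lemma zeta_mx_reflection i k : reflection_mx (zeta_mx i k).
Proof.
rewrite /zeta_mx; case: ifP => _; first exact: sigma_reflection.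
by case: ifP => _; [exact: gamma_reflection|exact: reflection_mx1].
Qed.

Lemma alpha_mx_reflection i k : reflection_mx (alpha_mx i k).
Proof.
by rewrite /alpha_mx; case: ifP => _; [exact: gamma_reflection|exact: reflection_mx1].
Qed.

Lemma beta_mx_reflection i k : reflection_mx (beta_mx i k).
Proof.
rewrite /beta_mx; case: ifP => _; first exact: gamma_reflection.
by apply: sigma_reflection; exact: signM.
Qed.

Lemma eta_mx_reflection i k : reflection_mx (eta_mx i k).
Proof.
by rewrite /eta_mx; case: ifP => _; [exact: tau_reflection|exact: reflection_mx1].
Qed.

Variables (K : hilbertType R) (tens : (nat -> 'cV[R[i]]_2) -> K).
Hypothesis K_tensor : infinite_tensor tens.
Let v := tens (fun=> e0 R).

Lemma zeta_reflection i : reflection (zeta tens s i).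
Proof.
exact: (infinite_tensor_op_reflection K_tensor (finite_set1 i) (@zeta_mx_local i)
  (zeta_mx_reflection i)).
Qed.

Lemma alpha_reflection i : reflection (alpha tens i).
Proof.
exact: (infinite_tensor_op_reflection K_tensor (finite_set1 i) (@alpha_mx_local i)
  (alpha_mx_reflection i)).
Qed.

Lemma beta_reflection i : reflection (beta tens s r i).
Proof.
exact: (infinite_tensor_op_reflection K_tensor (finite_set1 i) (@beta_mx_local i)
  (beta_mx_reflection i)).
Qed.

Lemma eta_reflection i : reflection (eta tens rho i).
Proof.
exact: (infinite_tensor_op_reflection K_tensor (finite_set1 i) (@eta_mx_local i)
  (eta_mx_reflection i)).
Qed.

Lemma theta_acts i : acts_as tens (theta tens i) (fun=> 1%:M).
Proof.
apply: (infinite_tensor_op_acts K_tensor (finite_set1 i) (@theta_mx_local i)).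
by move=> k; exact: reflection_mx1.
Qed.

Lemma theta1 i : theta tens i = 1.
Proof. exact: (acts_as_inj K_tensor (@theta_acts i) (@acts_as1 _ _ _)). Qed.

Lemma zeta_acts i : acts_as tens (zeta tens s i) (zeta_mx i).
Proof.
exact: (infinite_tensor_op_acts K_tensor (finite_set1 i) (@zeta_mx_local i)
  (zeta_mx_reflection i)).
Qed.

Lemma alpha_acts i : acts_as tens (alpha tens i) (alpha_mx i).
Proof.
exact: (infinite_tensor_op_acts K_tensor (finite_set1 i) (@alpha_mx_local i)
  (alpha_mx_reflection i)).
Qed.

Lemma beta_acts i : acts_as tens (beta tens s r i) (beta_mx i).
Proof.
exact: (infinite_tensor_op_acts K_tensor (finite_set1 i) (@beta_mx_local i)
  (beta_mx_reflection i)).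
Qed.

Lemma eta_acts i : acts_as tens (eta tens rho i) (eta_mx i).
Proof.
exact: (infinite_tensor_op_acts K_tensor (finite_set1 i) (@eta_mx_local i)
  (eta_mx_reflection i)).
Qed.

Lemma zeta_vacuum i : hdot v (zeta tens s i v) = 0.
Proof.
rewrite (acts_as_single K_tensor (@zeta_mx_local i) (@zeta_acts i)).
by rewrite /zeta_mx ltnn eqxx dot2_mx2.
Qed.

(** Only site [i] matters, and there the two copies of [gamma_mx] cancel. *)
Lemma alpha_beta_vacuum i : hdot v ((alpha tens i * beta tens s r i) v) = 1.
Proof.
have l : local_mx [set i]%classic (fun k => alpha_mx i k *m beta_mx i k).
  by move=> k ki; apply: fixes_e0_mul; [exact: alpha_mx_local|exact: beta_mx_local].
rewrite (acts_as_single K_tensor l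
  (acts_as_mul (finite_set1 i) (@beta_mx_local i) (@alpha_acts i) (@beta_acts i))).
by rewrite /alpha_mx /beta_mx eqxx (gamma_reflection R).2 mul1mx dot2_e0.
Qed.

(** The covariance enters the model here, as the upper left entry of [tau_mx rho]. *)
Lemma eta_vacuum i : hdot v (eta tens rho i v) = rho%:C.
Proof.
rewrite (acts_as_single K_tensor (@eta_mx_local i) (@eta_acts i)).
by rewrite /eta_mx eqxx dot2_mx2.
Qed.

Lemma zeta_commute i j : i != j ->
  zeta tens s i * zeta tens s j = s i j *: (zeta tens s j * zeta tens s i).
Proof.
(* The sign arises only at the smaller of the two sites, where a gamma meets a sigma; at the larger
   one a gamma meets the identity. *)
move=> ij; pose c k := if ((k == i) || (k == j)) && ((k < i) || (k < j))%N
  then s i j else 1.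
have -> : s i j = c i * c j.
  rewrite /c !eqxx orbT !ltnn orbF /=.
  by case: ltngtP ij => //; rewrite ?mulr1 ?mul1r.
apply: (infinite_tensor_op_commute K_tensor (finite_set1 i) (@zeta_mx_local i)
  (zeta_mx_reflection i) (finite_set1 j) (@zeta_mx_local j) (zeta_mx_reflection j) ij).
  by move=> k /negPf ki /negPf kj; rewrite /c ki kj.
move=> k; rewrite -/(zeta_mx i k) -/(zeta_mx j k) /zeta_mx /c.
have [->|ki] := eqVneq k i.
  rewrite ltnn (negPf ij) /=; case: ltnP => _; first exact: gamma_sigma.
  by rewrite mulmx1 mul1mx scale1r.
have [->|kj] := eqVneq k j.
  rewrite ltnn orbF /=; case: ltnP => _.
    by rewrite s_sym; exact: sigma_gamma.
  by rewrite mulmx1 mul1mx scale1r.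
by rewrite scale1r; case: ifP => _; case: ifP => _;
  rewrite ?mulmx1 ?mul1mx//; exact: sigmaC.
Qed.

Lemma alpha_commute i j : i != j ->
  alpha tens i * alpha tens j = 1 *: (alpha tens j * alpha tens i).
Proof.
move=> ij; rewrite -[1]mulr1.
apply: (infinite_tensor_op_commute K_tensor (c := fun=> 1) (finite_set1 i)
  (@alpha_mx_local i) (alpha_mx_reflection i) (finite_set1 j) (@alpha_mx_local j)
  (alpha_mx_reflection j) ij) => // k.
by rewrite /alpha_mx scale1r; case: ifP => _; case: ifP => _; rewrite ?mulmx1 ?mul1mx.
Qed.

Lemma eta_commute i j : i != j ->
  eta tens rho i * eta tens rho j = 1 *: (eta tens rho j * eta tens rho i).
Proof.
move=> ij; rewrite -[1]mulr1.
apply: (infinite_tensor_op_commute K_tensor (c := fun=> 1) (finite_set1 i)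
  (@eta_mx_local i) (eta_mx_reflection i) (finite_set1 j) (@eta_mx_local j)
  (eta_mx_reflection j) ij) => // k.
by rewrite /eta_mx scale1r; case: ifP => _; case: ifP => _; rewrite ?mulmx1 ?mul1mx.
Qed.

Lemma beta_commute i j : i != j ->
  beta tens s r i * beta tens s r j = 1 *: (beta tens s r j * beta tens s r i).
Proof.
(* A gamma meets a sigma at both sites. By symmetry of [s] and [r] the two signs agree, so their
   product is 1. *)
move=> ij; pose c k := if (k == i) || (k == j) then s i j * r i j else 1.
have sr : sign (s i j * r i j) by exact: signM.
have -> : 1 = c i * c j by rewrite /c !eqxx orbT sign_sqr.
apply: (infinite_tensor_op_commute K_tensor (finite_set1 i) (@beta_mx_local i)
  (beta_mx_reflection i) (finite_set1 j) (@beta_mx_local j) (beta_mx_reflection j) ij).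
  by move=> k /negPf ki /negPf kj; rewrite /c ki kj.
move=> k; rewrite -/(beta_mx i k) -/(beta_mx j k) /beta_mx /c.
have [->|ki] := eqVneq k i; first by rewrite (negPf ij); exact: gamma_sigma.
have [->|kj] := eqVneq k j; last by rewrite scale1r; exact: sigmaC.
by rewrite (s_sym j) (r_sym j); exact: sigma_gamma.
Qed.

Lemma alpha_beta_commute i j : i != j ->
  alpha tens i * beta tens s r j = (s i j * r i j) *: (beta tens s r j * alpha tens i).
Proof.
(* Only site [i] contributes a sign: at site [j] the factor of [alpha] is the identity. *)
move=> ij; pose c k := if k == i then s i j * r i j else 1.
have sr : sign (s i j * r i j) by exact: signM.
have -> : s i j * r i j = c i * c j.
  by rewrite /c !eqxx [j == i]eq_sym (negPf ij) mulr1.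
apply: (infinite_tensor_op_commute K_tensor (finite_set1 i) (@alpha_mx_local i)
  (alpha_mx_reflection i) (finite_set1 j) (@beta_mx_local j) (beta_mx_reflection j) ij).
  by move=> k /negPf ki /negPf kj; rewrite /c ki.
move=> k; rewrite -/(alpha_mx i k) -/(beta_mx j k) /alpha_mx /beta_mx /c.
have [->|ki] := eqVneq k i; first by rewrite (negPf ij); exact: gamma_sigma.
by rewrite mulmx1 mul1mx scale1r.
Qed.

Lemma theta_commute i S : S * theta tens i = 1 *: (theta tens i * S).
Proof. by rewrite theta1 mulr1 mul1r scale1r. Qed.

Lemma theta_reflection i : reflection (theta tens i).
Proof. by rewrite theta1; exact: reflection1. Qed.

End SiteMatrices.

(** * Verification of the hypotheses for the model *)

Theorem theorem2 (R : realType) (rho : R) (rho_lt1 : `|rho| < 1)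
    (s r : nat -> nat -> R[i])
    (s_sign : forall i j, (i < j)%N -> s i j = 1 \/ s i j = -1)
    (r_sign : forall i j, r i j = 1 \/ r i j = -1)
    (r_sym : forall i j, r i j = r j i)
    (K : hilbertType R) (tens : (nat -> 'cV[R[i]]_2) -> K)
    (K_tensor : infinite_tensor tens)
    (K3 : hilbertType R) (tens3 : K -> K -> K -> K3)
    (K3_tensor : triple_tensor tens3) :
  let s' := symmetrize s in
  let v := tens (fun=> e0 R) in
  let phi := vector_state (tens3 v v v) in
  let a i := triple_tensor_op tens3
    (zeta tens s' i) (alpha tens i) (eta tens rho i) in
  let b i := triple_tensor_op tens3
    (zeta tens s' i) (beta tens s' r i) (theta tens i) in
  main_hypotheses phi a b rho s' r.
Proof.
move=> s' v phi a b.
have ss' i j : sign (s' i j) by exact: symmetrize_sign.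
have s'_sym i j : s' i j = s' j i by exact: symmetrizeC.
have rz := zeta_reflection ss' K_tensor; have ra := alpha_reflection K_tensor.
have rb := beta_reflection ss' r_sign K_tensor.
have re := eta_reflection rho_lt1 K_tensor; have rt := theta_reflection K_tensor.
have Aa i := triple_tensor_op_acts K3_tensor (rz i) (ra i) (re i).
have Ab i := triple_tensor_op_acts K3_tensor (rz i) (rb i) (rt i).
have Ra i := triple_tensor_op_reflection K3_tensor (rz i) (ra i) (re i).
have Rb i := triple_tensor_op_reflection K3_tensor (rz i) (rb i) (rt i).
have st : state phi by exact: (vacuum_state K3_tensor K_tensor).
have phi1 : phi 1 = 1 by case: st.
have la i : local_op3 tens3 tens [set i]%classic (a i).
  exists (zeta tens s' i), (alpha tens i), (eta tens rho i); split; first exact: Aa.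
  - by exists (zeta_mx s' i); [exact: zeta_acts|exact: zeta_mx_local].
  - by exists (alpha_mx R i); [exact: alpha_acts|exact: alpha_mx_local].
  - by exists (eta_mx rho i); [exact: eta_acts|exact: eta_mx_local].
have lb i : local_op3 tens3 tens [set i]%classic (b i).
  exists (zeta tens s' i), (beta tens s' r i), (theta tens i); split; first exact: Ab.
  - by exists (zeta_mx s' i); [exact: zeta_acts|exact: zeta_mx_local].
  - by exists (beta_mx s' r i); [exact: beta_acts|exact: beta_mx_local].
  - by exists (fun=> 1%:M); [exact: theta_acts|exact: theta_mx_local].
split=> //.
- by move=> i; split; [exact: (Ra i).1|exact: (Rb i).1].
- move=> i; rewrite /phi (vacuum_acts K3_tensor _ (Aa i)).
  rewrite (vacuum_acts K3_tensor _ (Ab i)).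
  by rewrite zeta_vacuum// !mul0r.
- split; first by rewrite -ltr_norml.
  move=> i; split; rewrite ?expr2 ?(Ra i).2 ?(Rb i).2//.
  (* The three legs of [a i * b i] have expectations 1, 1 and [rho]: [zeta] squares to 1, [alpha]
     times [beta] gives 1, and [eta] gives [rho]. *)
  rewrite /phi (vacuum_acts K3_tensor _ (acts_as3_mul (Aa i) (Ab i))).
  rewrite (rz i).2 alpha_beta_vacuum// theta1// mulr1 eta_vacuum//.
  by rewrite /= (hdot_vacuum K_tensor) !mul1r.
- exists (fun=> 1) => // n i c _ cE; apply: (phi_prod_reflections K3_tensor K_tensor) => // j.
  by case: (cE j) => ->; [exact: Ra|exact: Rb].
- move=> n i g _ inc_i lg; apply: (phi_prod_independent K3_tensor K_tensor (i := i)) => //.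
    move=> l m lm; apply: val_inj; case: (ltngtP l m) => // /inc_i;
      by rewrite lm ltnn.
  move=> m; apply: (generated_local K3_tensor K_tensor _ _ (lg m)) => //.
  by move=> V [->|->]; [exact: la|exact: lb].
- by move=> i j; split; [exact: ss'|exact: r_sign].
- move=> i j ij; split.
  + rewrite (triple_tensor_op_commute K3_tensor (rz i) (ra i) (re i) (rz j) (ra j) (re j)
      (zeta_commute ss' s'_sym K_tensor ij) (alpha_commute K_tensor ij)
      (eta_commute rho_lt1 K_tensor ij)).
    by rewrite !mulr1.
  + rewrite (triple_tensor_op_commute K3_tensor (rz i) (rb i) (rt i) (rz j) (rb j) (rt j)
      (zeta_commute ss' s'_sym K_tensor ij)
      (beta_commute ss' r_sign s'_sym r_sym K_tensor ij) (theta_commute K_tensor _ _)).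
    by rewrite !mulr1.
  (* The legs contribute [s' i j], [s' i j * r i j] and 1; the square of [s' i j] is 1, leaving
     [r i j]. *)
  + rewrite (triple_tensor_op_commute K3_tensor (rz i) (ra i) (re i) (rz j) (rb j) (rt j)
      (zeta_commute ss' s'_sym K_tensor ij)
      (alpha_beta_commute ss' r_sign K_tensor ij) (theta_commute K_tensor _ _)).
    by rewrite mulr1 mulrA sign_sqr// mul1r.
Qed.
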